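(* Let $S\subseteq\mathbb{R}$ be a measurable set of positive finite Lebesgue measure and let $\Lambda\subseteq\mathbb{R}$ be uniformly discrete. If $E(\Lambda)$ is uniformly complete in $L^2(S)$, then $$D^-(\Lambda)\geq |S|.$$
   Context: $|S|$ denotes the Lebesgue measure of $S$. A set $\Lambda\subseteq\mathbb{R}$ is uniformly discrete if there is a constant $\delta>0$ with $|\lambda-\gamma|\ge\delta$ for all distinct $\lambda,\gamma\in\Lambda$. For $w\in\mathbb{R}$ put $e_w(t)=e^{2\pi i w t}$, and let $E(\Lambda)=\{e_\lambda\}_{\lambda\in\Lambda}$, regarded as a system in $L^2(S)$. Lower density: $D^-(\Lambda)=\lim_{r\to\infty}\frac{1}{r}\min_{x\in\mathbb{R}}\#(\Lambda\cap[x,x+r])$. Definition. $E(\Lambda)$ is uniformly complete in $L^2(S)$ if there is a constant $C>0$ such that for every $w\in\mathbb{R}$ and every $\epsilon>0$ there exists a (finite) linear combination $p_w=\sum_{\lambda\in\Lambda}a_\lambda(w)e_\lambda$ (with complex coefficients, which may depend on $w$ and $\epsilon$) satisfying $$\|e_w-p_w\|_{L^2(S)}<\epsilon\qquad\text{and}\qquad \sum_{\lambda\in\Lambda}|a_\lambda(w)|^2\le C.$$ The constant $C$ does not depend on $w$ or on $\epsilon$. *)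

(* Defs.v *)
From mathcomp Require Import all_boot all_order all_algebra finmap.
From mathcomp Require Import complex.
From mathcomp Require Import all_classical all_reals all_analysis.
Set Implicit Arguments.
Unset Strict Implicit.
Unset Printing Implicit Defensive.
Import Order.TTheory GRing.Theory Num.Theory.
Import numFieldNormedType.Exports.

Local Open Scope classical_set_scope.
Local Open Scope ring_scope.

(* Lebesgue measurability, not Borel measurability: the default [measurable] on
   a [realType] is the Borel sigma-algebra, whereas this is the sigma-algebra on
   which [completed_lebesgue_measure] is defined. *)
Definition lebesgue_measurable (R : realType) (S : set R) : Prop :=
  ((wlength (@idfun R))^*)%mu.-cara.-measurable S.

Definition uniformly_discrete (R : realType) (L : set R) : Prop :=
  exists2 delta : R, 0 < delta &
    forall l g : R, L l -> L g -> l != g -> delta <= `|l - g|.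

(* The infimum is a minimum, since the counts lie in nat or equal +oo. *)
Definition min_count (R : realType) (L : set R) (r : R) : \bar R :=
  ereal_inf [set counting (L `&` `[x, (x + r)%R]) | x in [set: R]].

(* For uniformly discrete L this limit exists:
   min_count L r + min_count L s - 1 <= min_count L (r + s). *)
Definition lower_density (R : realType) (L : set R) : \bar R :=
  lim ((r^-1%:E * min_count L r)%E @[r --> +oo]).

Definition expi (R : realType) (w t : R) : R[i] :=
  Complex (cos (2 * pi * w * t)) (sin (2 * pi * w * t)).

(* [Normc.normc] is the real-valued modulus; [`|z|] would be valued in R[i]. *)
Definition L2norm (R : realType) (S : set R) (f : R -> R[i]) : \bar R :=
  'N[@completed_lebesgue_measure R]_2%:E[
    (fun t => (Normc.normc (f t))%:E) \_ S ]%E.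

Definition uniformly_complete (R : realType) (L S : set R) : Prop :=
  exists2 C : R, 0 < C &
    forall w eps : R, 0 < eps ->
      exists (F : {fset R}) (a : R -> R[i]),
        [/\ [set` F] `<=` L,
            (L2norm S (fun t =>
               (expi w t - \sum_(l <- F) a l * expi l t)%R) < eps%:E)%E &
            \sum_(l <- F) Normc.normc (a l) ^+ 2 <= C].

(* Main.v *)
Require Import Defs.
From mathcomp Require Import all_boot all_order all_algebra finmap.
From mathcomp Require Import complex ring lra.
From mathcomp Require Import all_classical all_reals all_analysis measurable_realfun.
Set Implicit Arguments.
Unset Strict Implicit.
Unset Printing Implicit Defensive.
Import Order.TTheory GRing.Theory Num.Theory.
Import numFieldNormedType.Exports.

Local Open Scope classical_set_scope.
Local Open Scope ring_scope.

(** The theorem compares the trace of a Gram matrix with its rank.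

    A compact K contained in S and in some [- M, M] may replace S: it can be
    taken of measure as close to that of S as desired, and the approximations
    on S restrict to K with the same bound C on the coefficients.  Fix a window
    [x, x + r] and the m, about 2 M (r - 2 rho), points v_k of the grid of step
    1 / (2 M) that lie inside it at distance at least rho from both ends.  The
    exponentials e_(v_k) are orthogonal on [- M, M], so the matrix T with
    entries <e_(v_k), e_(v_j)>_K / (2 M) is a compression of the multiplication
    by the indicator of K: its quadratic form is at most the identity
    ([gram_le]) and its trace is m |K| / (2 M) ([gram_trace]).

    Replacing e_(v_k) by its approximation p_(v_k) writes the columns of T as
    combinations of the vectors b_l = (<e_l, e_(v_j)>_K / (2 M))_j with l in
    Lambda, up to an error as small as desired.  The frequencies of the window
    contribute a matrix of rank at most the number n of points of Lambda in the
    window.  The others contribute a product A Y in which the columns of Y have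
    square norm at most C and the rows of A have small square norm, because
    their entries are values of the Fourier transform of the indicator of K at
    separated points of modulus at least rho ([fourier_tail]).  Projecting
    orthogonally to the range of the first matrix leaves trace at most n on the
    range, and the Cauchy-Schwarz inequality bounds the trace of the rest by a
    small multiple of m ([trace_le_rank]).  Hence n >= m (|K| / (2 M) - eps)
    ([grid_count]), which gives the density bound as r tends to infinity.

    That the Fourier transform of K is small in the mean square over far
    separated points comes from two facts.  It decays like 1 / |w| for a finite
    union of segments, and K differs from such a union by a set D of small
    measure; for D one uses the Bessel inequality of separated exponentials on a
    bounded interval ([bessel]), whose constant depends on the separation and on
    M alone.

    The limit that defines the density has to be shown to exist: the minimal
    count minus one is superadditive in the length of the window, so Fekete's
    lemma applies ([lower_density_lim]).

    Complex exponentials are handled as functions with values in the plane,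
    t |-> (cos (w t + th), sin (w t + th)), for the real scalar product.  The
    phase th runs over 0 and pi / 2, the second value standing for the
    multiplication by i; this doubles the trace and the rank alike.  The scalar
    product of two such functions over D is the integral over D of
    cos ((w - w') t + (th - th')), which is why the whole proof is about the
    numbers [cosint]. *)

(** * Trace and rank *)

(** Gram-Schmidt orthogonalization, one column at a time: a column u adds to P
    the rank-one projection onto c = u - P u, unless c vanishes. *)
Lemma colspan_projection (R : realFieldType) (m n : nat) (B : 'M[R]_(m, n)) :
  exists P : 'M[R]_m,
    [/\ P^T = P, P *m P = P, P *m B = B & \tr P <= n%:R].
Proof.
elim: n B => [|n IHn] B.
  exists 0; split; rewrite ?trmx0 ?mul0mx ?mxtrace0 //.
  by rewrite [B]thinmx0.
have [P [PT PP PB Ptr]] := IHn (@rsubmx R m 1 n B).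
pose u := @lsubmx R m 1 n B; pose c := u - P *m u.
have Pc : P *m c = 0 by rewrite mulmxBr mulmxA PP subrr.
have cP : c^T *m P = 0 by rewrite -[P]trmxK -trmx_mul PT Pc trmx0.
pose d := (c^T *m c) 0 0.
have dE : c^T *m c = d%:M by rewrite [LHS]mx11_scalar.
have cPB : c^T *m @rsubmx R m 1 n B = 0 by rewrite -PB mulmxA cP mul0mx.
have cu : c^T *m u = d%:M.
  have -> : u = c + P *m u by rewrite /c subrK.
  by rewrite mulmxDr mulmxA cP mul0mx addr0.
have BE : B = @row_mx R m 1 n u (@rsubmx R m 1 n B) by rewrite hsubmxK.
have [d0|dn0] := eqVneq d 0.
  have c0 : c = 0.
    apply/matrixP => i j; rewrite !mxE ord1.
    have /eqP : \sum_k c k 0 ^+ 2 = 0.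
      transitivity d => //; rewrite /d [RHS]mxE.
      by apply: eq_bigr => k _; rewrite [c^T _ _]mxE expr2.
    rewrite psumr_eq0 => [/allP|k _]; last exact: sqr_ge0.
    move=> /(_ i (mem_index_enum i)) /=; rewrite sqrf_eq0 => /eqP.
    by rewrite !mxE.
  exists P; split => //; last by rewrite (le_trans Ptr)// ler_nat.
  rewrite BE; transitivity (row_mx (P *m u) (P *m @rsubmx R m 1 n B)).
    exact: (@mul_mx_row R m m 1 n).
  have -> : P *m u = u by apply/esym/eqP; rewrite -subr_eq0; apply/eqP.
  by rewrite PB.
exists (P + d^-1 *: (c *m c^T)); split.
- by rewrite linearD /= linearZ /= trmx_mul trmxK PT.
- rewrite mulmxDl !mulmxDr PP -!scalemxAl -!scalemxAr !mulmxA Pc mul0mx scaler0.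
  rewrite -(mulmxA c c^T P) cP mulmx0 scaler0 addr0 add0r.
  rewrite -(mulmxA c c^T c) dE mul_mx_scalar -scalemxAl !scalerA.
  by rewrite mulVf ?mulr1.
- rewrite [in LHS]BE.
  transitivity (row_mx ((P + d^-1 *: (c *m c^T)) *m u)
     ((P + d^-1 *: (c *m c^T)) *m @rsubmx R m 1 n B)); first exact: (@mul_mx_row R m m 1 n).
  have -> : (P + d^-1 *: (c *m c^T)) *m u = u.
    rewrite mulmxDl -scalemxAl -mulmxA cu mul_mx_scalar scalerA mulVf //.
    by rewrite scale1r addrC subrK.
  by rewrite mulmxDl -scalemxAl -mulmxA cPB mulmx0 scaler0 addr0 PB -BE.
- rewrite mxtraceD mxtraceZ mxtrace_mulC dE mxtrace_scalar mulr1n mulVf //.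
  by rewrite -natr1 lerD2r.
Qed.

Lemma mxtrace_gram (R : realFieldType) (m n : nat) (A : 'M[R]_(m, n)) :
  \tr (A^T *m A) = \sum_i \sum_j A i j ^+ 2.
Proof.
rewrite exchange_big /=; apply: eq_bigr => j _; rewrite mxE.
by apply: eq_bigr => i _; rewrite mxE expr2.
Qed.

Lemma sum_mul_le (R : realFieldType) (I : Type) (r : seq I) (f g : I -> R)
  (s : R) : 0 < s ->
  \sum_(i <- r) f i * g i <=
  (s * \sum_(i <- r) f i ^+ 2 + s^-1 * \sum_(i <- r) g i ^+ 2) / 2.
Proof.
move=> s0; rewrite !mulr_sumr -big_split /= mulr_suml; apply: ler_sum => i _.
rewrite -subr_ge0.
have -> : (s * f i ^+ 2 + s^-1 * g i ^+ 2) / 2 - f i * g i =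
  s^-1 * (s * f i - g i) ^+ 2 / 2 by field; rewrite gt_eqF.
by rewrite divr_ge0// mulr_ge0 ?sqr_ge0// invr_ge0 ltW.
Qed.

(** With P the projection onto the columns of B, T = P T + (A - P A) Y.  The
    trace of P T equals that of P T P, which is at most that of P because T is
    at most the identity; the second term is estimated by the Cauchy-Schwarz
    inequality, and A - P A is no larger than A. *)
Lemma mxtrace_le_rank (R : realFieldType) (m n q : nat) (T : 'M[R]_m)
  (B : 'M[R]_(m, n)) (X : 'M[R]_(n, m)) (A : 'M[R]_(m, q)) (Y : 'M[R]_(q, m))
  (s : R) : 0 < s -> T = B *m X + A *m Y ->
  (forall x : 'cV[R]_m, (x^T *m T *m x) 0 0 <= (x^T *m x) 0 0) ->
  \tr T <= n%:R + (s * (\sum_i \sum_j A i j ^+ 2) +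
                   s^-1 * (\sum_i \sum_j Y i j ^+ 2)) / 2.
Proof.
move=> s0 TE T1; have [P [PT PP PB Ptr]] := colspan_projection B.
have diag k (M : 'M[R]_k) i :
    M i i = ((col i 1%:M)^T *m M *m col i 1%:M) 0 0.
  by rewrite colE mul1mx trmx_delta -rowE -colE !mxE.
have PTle : \tr (P *m T) <= \tr P.
  have -> : \tr (P *m T) = \tr (P *m T *m P).
    by rewrite -{1}PP -mulmxA mxtrace_mulC.
  have -> : \tr P = \tr (P *m P) by rewrite PP.
  apply: ler_sum => i _.
  rewrite (diag _ (P *m T *m P)) (diag _ (P *m P)).
  have := T1 (P *m col i 1%:M).
  by rewrite trmx_mul PT !mulmxA.
pose A' := A - P *m A.
have A'le : \sum_i \sum_j A' i j ^+ 2 <= \sum_i \sum_j A i j ^+ 2.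
  have A'T : A'^T = A^T - A^T *m P by rewrite linearB /= trmx_mul PT.
  rewrite -!mxtrace_gram A'T mulmxBl !mulmxBr.
  rewrite !mulmxA -(mulmxA _ P P) PP subrr subr0 mxtraceD raddfN /=.
  rewrite gerDl oppr_le0.
  have -> : A^T *m P *m A = (P *m A)^T *m (P *m A).
    by rewrite trmx_mul PT mulmxA -(mulmxA _ P P) PP.
  by rewrite mxtrace_gram; do 2!(apply: sumr_ge0 => ? _); exact: sqr_ge0.
have -> : T = P *m T + A' *m Y.
  have -> : P *m T = B *m X + P *m A *m Y by rewrite TE mulmxDr !mulmxA PB.
  by rewrite mulmxBl -addrA [X in _ + X]addrC subrK.
rewrite mxtraceD lerD ?(le_trans PTle)//.
have -> : \tr (A' *m Y) = \sum_(p : 'I_m * 'I_q) A' p.1 p.2 * Y p.2 p.1.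
  rewrite -(pair_big xpredT xpredT (fun i j => A' i j * Y j i)) /=.
  by apply: eq_bigr => i _; rewrite mxE.
apply: (le_trans (sum_mul_le _ _ _ s0)).
rewrite ler_pM2r ?invr_gt0// lerD// ler_pM2l ?invr_gt0//.
  by rewrite -(pair_big xpredT xpredT (fun i j => A' i j ^+ 2)).
rewrite -(pair_big xpredT xpredT (fun i j => Y j i ^+ 2)) /=.
by rewrite exchange_big.
Qed.

(** The same inequality for matrices indexed by arbitrary finite types, in which
    frequencies and phases can serve as indices. *)
Lemma trace_le_rank (R : realFieldType) (I N Q : finType) (T : I -> I -> R)
  (B : I -> N -> R) (X : N -> I -> R) (A : I -> Q -> R) (Y : Q -> I -> R)
  (s : R) : 0 < s ->
  (forall i j, T i j = \sum_k B i k * X k j + \sum_k A i k * Y k j) ->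
  (forall x : I -> R, \sum_i \sum_j x i * x j * T i j <= \sum_i x i ^+ 2) ->
  \sum_i T i i <= #|N|%:R + (s * (\sum_i \sum_j A i j ^+ 2) +
                             s^-1 * (\sum_i \sum_j Y i j ^+ 2)) / 2.
Proof.
move=> s0 TE T1.
have sumE (J : finType) (f : J -> R) :
    \sum_j f j = \sum_(k < #|J|) f (enum_val k).
  by rewrite (reindex _ (onW_bij _ (@enum_val_bij J))).
pose mx (J K : finType) (f : J -> K -> R) :=
  \matrix_(i < #|J|, j < #|K|) f (enum_val i) (enum_val j).
have := @mxtrace_le_rank R _ _ _ (mx _ _ T) (mx _ _ B) (mx _ _ X) (mx _ _ A)
  (mx _ _ Y) s s0.
have sqE (J K : finType) (f : J -> K -> R) :
    \sum_i \sum_j mx _ _ f i j ^+ 2 = \sum_i \sum_j f i j ^+ 2.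
  rewrite [RHS]sumE; apply: eq_bigr => i _; rewrite [RHS]sumE.
  by apply: eq_bigr => j _; rewrite mxE.
rewrite !sqE (sumE I) => H; apply: le_trans (H _ _).
- rewrite le_eqVlt; apply/orP; left; apply/eqP.
  by apply: eq_bigr => i _; rewrite mxE.
- apply/matrixP => i j; rewrite !mxE TE (sumE N) (sumE Q).
  by congr (_ + _); apply: eq_bigr => k _; rewrite !mxE.
- move=> x; have := T1 (fun i => x (enum_rank i) 0).
  have -> : \sum_i x (enum_rank i) 0 ^+ 2 = (x^T *m x) 0 0.
    rewrite sumE mxE; apply: eq_bigr => i _.
    by rewrite enum_valK mxE expr2.
  apply: le_trans; rewrite le_eqVlt; apply/orP; left; apply/eqP.
  rewrite mxE exchange_big [RHS](sumE I) /=.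
  apply: eq_bigr => j _; rewrite mxE mulr_suml [RHS](sumE I).
  by apply: eq_bigr => i _; rewrite !mxE !enum_valK mulrAC.
Qed.

(** * Integration of continuous functions over bounded sets *)

Definition bounded_measurable (R : realType) (D : set R) : Prop :=
  measurable D /\ exists M : R, D `<=` `[- M, M].

Local Notation integ D f := (\int[@lebesgue_measure _]_(t in D) f t) (only parsing).
Local Notation leb D := (fine (@lebesgue_measure _ D)) (only parsing).

Section integration.
Context (R : realType).
Implicit Types (D E : set R) (f g : R -> R).
Local Notation mu := (@lebesgue_measure R).

Lemma bounded_measurable_itv (a b : R) : bounded_measurable `[a, b].
Proof.
split; first exact: measurable_itv.
exists (`|a| + `|b|) => t /=; rewrite !in_itv /= => /andP[ta tb].
have := ler_norm b; have := ler_norm (- a); rewrite normrN.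
have := normr_ge0 a; have := normr_ge0 b.
by move=> *; apply/andP; split; lra.
Qed.

Lemma bounded_measurableS D E : bounded_measurable E -> measurable D ->
  D `<=` E -> bounded_measurable D.
Proof.
by move=> [_ [M EM]] mD DE; split=> //; exists M; exact: subset_trans EM.
Qed.

Lemma bounded_measurable_fin D : bounded_measurable D -> mu D \is a fin_num.
Proof.
move=> [mD [M DM]]; rewrite ge0_fin_numE; last exact: measure_ge0.
apply: (@le_lt_trans _ _ (mu `[- M, M])).
  by apply: le_measure; rewrite ?inE //; exact: measurable_itv.
rewrite lebesgue_measure_itv /=; case: ifP => _; last exact: ltry.
by rewrite -EFinB ltry.
Qed.

Lemma continuous_integrable D f : bounded_measurable D -> continuous f ->
  mu.-integrable D (EFin \o f).
Proof.
move=> [mD [M DM]] cf; apply: (@integrableS _ _ R mu `[- M, M] D (EFin \o f)) => //.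
apply: continuous_compact_integrable; first exact: segment_compact.
exact: continuous_subspaceT.
Qed.

Lemma integD D f g : bounded_measurable D -> continuous f -> continuous g ->
  integ D (fun t => f t + g t) = integ D f + integ D g.
Proof.
move=> bD cf cg.
by rewrite RintegralD//; [exact: bD.1|exact: continuous_integrable..].
Qed.

Lemma integZ D f (c : R) : bounded_measurable D -> continuous f ->
  integ D (fun t => c * f t) = c * integ D f.
Proof.
move=> bD cf.
by rewrite RintegralZl//; [exact: bD.1|exact: continuous_integrable].
Qed.

Lemma le_integ D f g : bounded_measurable D -> continuous f -> continuous g ->
  (forall t, D t -> f t <= g t) -> integ D f <= integ D g.
Proof.
move=> bD cf cg fg.
by apply: le_Rintegral => //; [exact: bD.1|exact: continuous_integrable..].
Qed.

Lemma integ_cst D (c : R) : bounded_measurable D ->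
  \int[mu]_(t in D) c = c * leb D.
Proof. by move=> bD; rewrite Rintegral_cst//; exact: bD.1. Qed.

Lemma continuous_sum (I : Type) (r : seq I) (F : I -> R -> R) :
  (forall i, continuous (F i)) -> continuous (fun t => \sum_(i <- r) F i t).
Proof.
move=> cF; elim: r => [|i r IH].
  rewrite (_ : (fun _ => _) = cst 0); first by move=> t; exact: cvg_cst.
  by apply/funext => t; rewrite big_nil.
rewrite (_ : (fun _ => _) = (fun t => F i t + \sum_(j <- r) F j t)).
  by move=> t; apply: cvgD; [exact: cF|exact: IH].
by apply/funext => t; rewrite big_cons.
Qed.

Lemma integ_sum (I : Type) (r : seq I) D (F : I -> R -> R) :
  bounded_measurable D -> (forall i, continuous (F i)) ->
  integ D (fun t => \sum_(i <- r) F i t) = \sum_(i <- r) integ D (F i).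
Proof.
move=> bD cF; elim: r => [|i r IH].
  under eq_Rintegral do rewrite big_nil.
  by rewrite integ_cst // mul0r big_nil.
under eq_Rintegral do rewrite big_cons.
by rewrite integD // ?IH ?big_cons //; exact: continuous_sum.
Qed.

Lemma le_integ_set D E f : bounded_measurable E -> measurable D ->
  D `<=` E -> continuous f -> (forall t, 0 <= f t) -> integ D f <= integ E f.
Proof.
move=> bE mD DE cf f0; rewrite /Rintegral fine_le//.
- apply: integrable_fin_num => //; apply: continuous_integrable => //.
  exact: bounded_measurableS bE mD DE.
- apply: integrable_fin_num; [exact: bE.1|exact: continuous_integrable].
- apply: ge0_subset_integral => //; [exact: bE.1| |by move=> t _; rewrite lee_fin].
  by case/integrableP: (continuous_integrable bE cf).
Qed.

Lemma integ_setU D E f : bounded_measurable (D `|` E) ->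
  measurable D -> measurable E -> D `&` E = set0 -> continuous f ->
  integ (D `|` E) f = integ D f + integ E f.
Proof.
move=> bDE mD mE DE cf; apply: Rintegral_setU => //.
  exact: continuous_integrable.
by apply/disj_setPS; rewrite DE.
Qed.

Lemma continuous_cos_affine (w th : R) : continuous (fun t => cos (w * t + th)).
Proof.
move=> t; apply: (@continuous_comp _ _ _ (fun t => w * t + th) cos).
  by apply: cvgD; [apply: cvgM; [exact: cvg_cst|exact: cvg_id]|exact: cvg_cst].
exact: continuous_cos.
Qed.

Lemma continuous_sin_affine (w th : R) : continuous (fun t => sin (w * t + th)).
Proof.
move=> t; apply: (@continuous_comp _ _ _ (fun t => w * t + th) sin).
  by apply: cvgD; [apply: cvgM; [exact: cvg_cst|exact: cvg_id]|exact: cvg_cst].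
exact: continuous_sin.
Qed.

Lemma integ_cos_itv (w th a b : R) : w != 0 -> a <= b ->
  integ `[a, b] (fun t => cos (w * t + th)) =
  (sin (w * b + th) - sin (w * a + th)) / w.
Proof.
move=> w0; rewrite le_eqVlt => /predU1P[->|ab].
  by rewrite subrr mul0r set_itv1 Rintegral_set1.
have dF (x : R) : is_derive x 1 (fun t : R => sin (w * t + th) / w) (cos (w * x + th)).
  apply: is_derive_eq; rewrite /GRing.scale /=.
  by field.
rewrite /Rintegral (@continuous_FTC2 _ _ (fun t => sin (w * t + th) / w)) //.
- by rewrite -EFinB /= mulrBl.
- by apply: continuous_subspaceT; exact: continuous_cos_affine.
- split; first by move=> x _; exact: ex_derive.
  + apply: cvg_at_right_filter; apply: cvgM; [|exact: cvg_cst].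
    exact: continuous_sin_affine.
  + apply: cvg_at_left_filter; apply: cvgM; [|exact: cvg_cst].
    exact: continuous_sin_affine.
- by move=> x _; rewrite derive1E; apply: derive_val.
Qed.

Lemma norm_integ_cos_itv (w th a b : R) : w != 0 ->
  `|integ `[a, b] (fun t => cos (w * t + th))| <= 2 / `|w|.
Proof.
move=> w0; have [ab|ba] := leP a b; last first.
  rewrite set_itv_ge ?bnd_simp -?ltNge// Rintegral_set0 normr0.
  by rewrite divr_ge0.
rewrite integ_cos_itv // normrM normfV ler_wpM2r ?invr_ge0//.
apply: (le_trans (ler_normB _ _)).
by rewrite (_ : 2 = 1 + 1) // lerD // sin_max.
Qed.

Lemma leb_itv (a b : R) : a <= b -> leb `[a, b] = b - a.
Proof.
rewrite le_eqVlt => /predU1P[->|ab].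
  by rewrite set_itv1 lebesgue_measure_set1 subrr.
by rewrite lebesgue_measure_itv /= lte_fin ab.
Qed.

End integration.

(** * Bessel inequality for separated exponentials *)

Section trigonometric_energy.
Context (R : realType) (I : finType).
Implicit Types (x a th : I -> R).

Definition cosint (D : set R) (w th : R) : R :=
  integ D (fun t => cos (w * t + th)).

(** The square norm of the plane-valued trigonometric polynomial with
    coefficients x, frequencies a and phases th. *)
Definition energy x a th (t : R) : R :=
  (\sum_i x i * cos (a i * t + th i)) ^+ 2 +
  (\sum_i x i * sin (a i * t + th i)) ^+ 2.

Lemma energyE x a th (t : R) : energy x a th t =
  \sum_i \sum_j x i * x j * cos ((a i - a j) * t + (th i - th j)).
Proof.
rewrite /energy !expr2 !mulr_suml -big_split /=; apply: eq_bigr => i _.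
rewrite !mulr_sumr -big_split /=; apply: eq_bigr => j _.
have -> : (a i - a j) * t + (th i - th j) =
  (a i * t + th i) - (a j * t + th j) by ring.
by rewrite cosB; ring.
Qed.

Lemma continuous_scale_cos (c w th : R) :
  continuous (fun t => c * cos (w * t + th)).
Proof.
move=> t; apply: cvgM; [exact: cvg_cst|exact: continuous_cos_affine].
Qed.

Lemma continuous_scale_sin (c w th : R) :
  continuous (fun t => c * sin (w * t + th)).
Proof.
move=> t; apply: cvgM; [exact: cvg_cst|exact: continuous_sin_affine].
Qed.

Lemma continuous_sqr (f : R -> R) :
  continuous f -> continuous (fun t => f t ^+ 2).
Proof. by move=> cf t; apply: cvgM; exact: cf. Qed.

Lemma continuous_energy x a th : continuous (energy x a th).
Proof.
move=> t; apply: cvgD; apply: continuous_sqr; apply: continuous_sum => i.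
  exact: continuous_scale_cos.
exact: continuous_scale_sin.
Qed.

Lemma integ_energy (D : set R) x a th : bounded_measurable D ->
  integ D (energy x a th) =
  \sum_i \sum_j x i * x j * cosint D (a i - a j) (th i - th j).
Proof.
move=> bD; under eq_Rintegral do rewrite energyE.
rewrite integ_sum// => [|i]; last first.
  by apply: continuous_sum => j; exact: continuous_scale_cos.
apply: eq_bigr => i _; rewrite integ_sum// => [|j]; last first.
  exact: continuous_scale_cos.
by apply: eq_bigr => j _; rewrite integZ //; exact: continuous_cos_affine.
Qed.

(** A bound for the average over s in [0, 1] of the integral of
    cos (w t + th) over [- (M + s), M + s].  One integral over a segment is only
    of order 1 / |w|, which is not summable over separated frequencies; the
    average over s gains a second factor 1 / |w|. *)
Definition averaged_kernel (M w : R) : R :=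
  if w == 0 then 2 * (M + 1) else 4 / w ^+ 2.

Lemma averaged_kernel_ge0 (M w : R) : 0 <= M -> 0 <= averaged_kernel M w.
Proof.
move=> M0; rewrite /averaged_kernel; case: ifP => _.
  by rewrite mulr_ge0// addr_ge0.
by rewrite divr_ge0// sqr_ge0.
Qed.

Lemma cosint_centered (A w th : R) : 0 <= A ->
  cosint `[- A, A] w th =
  if w == 0 then 2 * A * cos th else 2 * cos th / w * cos (w * A - pi / 2).
Proof.
move=> A0; have NAA : - A <= A by lra.
rewrite /cosint; case: ifPn => [/eqP ->|w0].
  under eq_Rintegral do rewrite mul0r add0r.
  rewrite integ_cst; last exact: bounded_measurable_itv.
  by rewrite leb_itv //; ring.
rewrite integ_cos_itv// cosBpihalf sinD mulrN sinD sinN cosN.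
by field.
Qed.

(** The energy being nonnegative, its integral over [- M, M] is at most its
    integral over each [- (M + s), M + s], hence at most the average of these
    integrals over s in [0, 1]. *)
Lemma integ_energy_le M x a th : 0 <= M ->
  integ `[- M, M] (energy x a th) <=
  \sum_i \sum_j `|x i| * `|x j| * averaged_kernel M (a i - a j).
Proof.
move=> M0; set G := integ _ _.
(* psi w h s is the integral of cos (w t + h) over [- (s + M), s + M] for
   s >= 0, in a form that is continuous in s on the whole line. *)
pose psi (w h : R) : R -> R := if w == 0 then fun s => 2 * cos h * (s + M)
  else fun s => 2 * cos h / w * cos (w * s + (w * M - pi / 2)).
have cpsi w h : continuous (psi w h).
  rewrite /psi; case: ifPn => _; last exact: continuous_scale_cos.
  move=> t; apply: cvgM; first exact: cvg_cst.
  by apply: cvgD; [exact: cvg_id|exact: cvg_cst].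
have psiE w h s : 0 <= s -> cosint `[- (s + M), s + M] w h = psi w h s.
  move=> s0; rewrite cosint_centered ?addr_ge0// /psi; case: ifP => _; first by ring.
  by congr (_ * cos _); ring.
have psi_le w h : `|integ `[0, 1] (psi w h)| <= averaged_kernel M w.
  rewrite /averaged_kernel; case: ifPn => w0.
    have -> : 2 * (M + 1) = integ `[0, 1] (fun=> 2 * (M + 1)).
      rewrite integ_cst; last exact: bounded_measurable_itv.
      by rewrite leb_itv// subr0 mulr1.
    have b01 : bounded_measurable `[0 : R, 1] by exact: bounded_measurable_itv.
    apply: le_trans (le_normr_Rintegral _ _) _; first exact: b01.1.
      exact: continuous_integrable.
    apply: le_integ => //.
    + by move=> t; apply: cvg_norm; exact: cpsi.
    + by move=> t; exact: cvg_cst.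
    + move=> t /=; rewrite in_itv /= => /andP[t0 t1].
      rewrite /psi w0 -mulrA normrM ger0_norm// ler_pM2l// normrM.
      rewrite (@ger0_norm _ (t + M)) ?addr_ge0//.
      apply: (@le_trans _ _ (1 * (t + M))); last by lra.
      by rewrite ler_wpM2r ?addr_ge0// cos_max.
  rewrite /psi (negbTE w0) integZ; last 2 first.
    exact: bounded_measurable_itv.
    exact: continuous_cos_affine.
  have wp : 0 < `|w| by rewrite normr_gt0.
  rewrite !normrM normfV ger0_norm//.
  apply: (@le_trans _ _ (2 / `|w| * (2 / `|w|))); last first.
    rewrite -[w ^+ 2]real_normK ?num_real//.
    by rewrite le_eqVlt; apply/orP; left; apply/eqP; field; rewrite gt_eqF.
  apply: ler_pM; rewrite ?mulr_ge0 ?invr_ge0//; last exact: norm_integ_cos_itv.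
  by rewrite ler_wpM2r ?invr_ge0// ler_piMr// cos_max.
have b01 : bounded_measurable `[0 : R, 1] by exact: bounded_measurable_itv.
have -> : G = integ `[0, 1] (fun=> G).
  by rewrite integ_cst // leb_itv// subr0 mulr1.
pose Psi s := \sum_i \sum_j x i * x j * psi (a i - a j) (th i - th j) s.
have cterm i j : continuous
    (fun s => x i * x j * psi (a i - a j) (th i - th j) s).
  by move=> t; apply: cvgM; [exact: cvg_cst|exact: cpsi].
have cPsi : continuous Psi.
  by do 2!(apply: continuous_sum => ?); exact: cterm.
apply: (@le_trans _ _ (integ `[0, 1] Psi)).
  apply: le_integ => //; first by move=> t; exact: cvg_cst.
  move=> s /=; rewrite in_itv /= => /andP[s0 s1].
  have -> : Psi s = integ `[- (s + M), s + M] (energy x a th).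
    rewrite integ_energy; last exact: bounded_measurable_itv.
    by do 2!(apply: eq_bigr => ? _); rewrite psiE.
  apply: le_integ_set; first exact: bounded_measurable_itv.
  - exact: measurable_itv.
  - by move=> t /=; rewrite !in_itv /= => /andP[? ?]; apply/andP; split; lra.
  - exact: continuous_energy.
  - by move=> t; rewrite addr_ge0 ?sqr_ge0.
rewrite integ_sum // => [|i]; last by apply: continuous_sum => j; exact: cterm.
apply: ler_sum => i _; rewrite integ_sum //; apply: ler_sum => j _.
rewrite integZ//; apply: le_trans (ler_norm _) _.
by rewrite !normrM ler_wpM2l ?mulr_ge0.
Qed.

Lemma schur_test x (k : I -> I -> R) (B : R) :
  (forall i j, 0 <= k i j) -> (forall i j, k i j = k j i) ->
  (forall i, \sum_j k i j <= B) ->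
  \sum_i \sum_j `|x i| * `|x j| * k i j <= B * \sum_i x i ^+ 2.
Proof.
move=> k0 ksym kB.
apply: (@le_trans _ _
    (\sum_i \sum_j (x i ^+ 2 / 2 * k i j + x j ^+ 2 / 2 * k j i))).
  apply: ler_sum => i _; apply: ler_sum => j _.
  rewrite [k j i]ksym -mulrDl ler_wpM2r//.
  rewrite -(real_normK (num_real (x i))) -(real_normK (num_real (x j))).
  rewrite -subr_ge0.
  have -> : `|x i| ^+ 2 / 2 + `|x j| ^+ 2 / 2 - `|x i| * `|x j| =
    (`|x i| - `|x j|) ^+ 2 / 2 by field.
  by rewrite divr_ge0// sqr_ge0.
have -> : \sum_i \sum_j (x i ^+ 2 / 2 * k i j + x j ^+ 2 / 2 * k j i) =
    \sum_i x i ^+ 2 * \sum_j k i j.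
  under eq_bigr do rewrite big_split /=.
  rewrite big_split /= [X in _ + X]exchange_big /= -big_split /=.
  apply: eq_bigr => i _; rewrite -!mulr_sumr -mulrDl; congr (_ * _).
  by rewrite -splitr.
by rewrite mulr_sumr; apply: ler_sum => i _; rewrite mulrC ler_wpM2r ?sqr_ge0.
Qed.

Lemma integ_energy_le_schur M B x a th : 0 <= M ->
  (forall i, \sum_j averaged_kernel M (a i - a j) <= B) ->
  integ `[- M, M] (energy x a th) <= B * \sum_i x i ^+ 2.
Proof.
move=> M0 kB; apply: le_trans (integ_energy_le _ _ _ M0) _.
apply: schur_test kB => i j; first exact: averaged_kernel_ge0.
by rewrite /averaged_kernel -[a j - a i]opprB oppr_eq0 sqrrN.
Qed.

(** The dual form of the preceding bound.  With x_i = cosint D (a_i) (th_i), the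
    sum X of the squares is the integral over D of p = sum x_i cos (a_i t + th_i),
    and p is at most B / 2 + p ^ 2 / (2 B), where p ^ 2 is bounded by the energy,
    of integral at most B X.  So X <= B |D| / 2 + X / 2. *)
Lemma bessel M B (D : set R) a th : 0 <= M -> 0 < B ->
  (forall i, \sum_j averaged_kernel M (a i - a j) <= B) ->
  measurable D -> D `<=` `[- M, M] ->
  \sum_i cosint D (a i) (th i) ^+ 2 <= B * leb D.
Proof.
move=> M0 B0 kB mD DM.
have bM := bounded_measurable_itv (- M) M.
have bD := bounded_measurableS bM mD DM.
pose x i := cosint D (a i) (th i).
pose p t := \sum_i x i * cos (a i * t + th i).
have cp : continuous p by apply: continuous_sum => i; exact: continuous_scale_cos.
rewrite -/(\sum_i x i ^+ 2); set X := \sum_i _.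
have XE : X = integ D p.
  rewrite integ_sum// => [|i]; last exact: continuous_scale_cos.
  apply: eq_bigr => i _; rewrite integZ ?expr2//.
  exact: continuous_cos_affine.
have p2 : integ D (fun t => p t ^+ 2) <= B * X.
  apply: le_trans (integ_energy_le_schur x th M0 kB).
  apply: (@le_trans _ _ (integ D (energy x a th))).
    apply: le_integ => //; [exact: continuous_sqr|exact: continuous_energy|].
    by move=> t _; rewrite lerDl sqr_ge0.
  apply: le_integ_set => //; first exact: continuous_energy.
  by move=> t; rewrite addr_ge0 ?sqr_ge0.
have : X <= B / 2 * leb D + (2 * B)^-1 * (B * X).
  rewrite {1}XE; apply: (@le_trans _ _
    (integ D (fun t => B / 2 + (2 * B)^-1 * p t ^+ 2))).
    apply: le_integ => //.
      move=> t; apply: cvgD; first exact: cvg_cst.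
      by apply: cvgM; [exact: cvg_cst|exact: continuous_sqr].
    move=> t _; rewrite -subr_ge0.
    have -> : B / 2 + (2 * B)^-1 * p t ^+ 2 - p t = (2 * B)^-1 * (p t - B) ^+ 2.
      by field; rewrite gt_eqF.
    by rewrite mulr_ge0 ?sqr_ge0// invr_ge0 mulr_ge0// ltW.
  rewrite integD//; last 2 first.
    by move=> t; exact: cvg_cst.
    by move=> t; apply: cvgM; [exact: cvg_cst|exact: continuous_sqr].
  rewrite integ_cst// lerD2l integZ//; last exact: continuous_sqr.
  by rewrite ler_wpM2l// invr_ge0 mulr_ge0// ltW.
have -> : (2 * B)^-1 * (B * X) = X / 2 by field; rewrite gt_eqF.
lra.
Qed.

End trigonometric_energy.

(** * Fourier transform of a compact set at far separated points *)

Definition separated (R : realType) (delta : R) (s : seq R) : Prop :=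
  {in s &, forall x y, x != y -> delta <= `|x - y|}.

Section separated_sums.
Context (R : realType) (delta : R) (delta_gt0 : 0 < delta).
Implicit Types (s : seq R) (x rho : R).

(** Telescoping: if x + delta <= y then 1 / y ^ 2 <= (1 / x - 1 / y) / delta. *)
Lemma sum_inv_sqr_path x s : 0 < x -> path (fun a b => a + delta <= b) x s ->
  \sum_(y <- s) (y ^+ 2)^-1 <= (delta * x)^-1.
Proof.
elim: s x => [|y s IH] x x0 /=.
  by rewrite big_nil => _; rewrite invr_ge0 mulr_ge0// ltW.
move=> /andP[xy pys]; have dp := delta_gt0; have y0 : 0 < y by lra.
rewrite big_cons; apply: le_trans (lerD (lexx _) (IH y y0 pys)) _.
rewrite -subr_ge0.
have -> : (delta * x)^-1 - ((y ^+ 2)^-1 + (delta * y)^-1) =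
  (delta * x * y ^+ 2)^-1 * (y * (y - x - delta) + delta * (y - x)).
  by field; rewrite ?gt_eqF.
apply: mulr_ge0; first by rewrite invr_ge0 !mulr_ge0 ?sqr_ge0// ltW.
apply: addr_ge0; apply: mulr_ge0; lra.
Qed.

Lemma sum_inv_sqr_pos rho s : 0 < rho -> uniq s -> separated delta s ->
  {in s, forall y, rho <= y} ->
  \sum_(y <- s) (y ^+ 2)^-1 <= (rho ^+ 2)^-1 + (delta * rho)^-1.
Proof.
move=> rho0 us seps srho.
rewrite -(perm_big _ (permEl (perm_sort <=%R s))) /=.
have : sorted (fun a b => a + delta <= b) (sort <=%R s).
  have : sorted <%R (sort <=%R s) by rewrite sort_lt_sorted.
  apply: (@sub_in_sorted _ (mem s)); last by apply/allP => y; rewrite mem_sort.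
  move=> a b /= sa sb ab; have := seps a b sa sb; rewrite lt_eqF// => /(_ isT).
  by rewrite distrC gtr0_norm ?subr_gt0//; lra.
case E: (sort _ _) => [|y t] /=.
  by move=> _; rewrite big_nil addr_ge0// invr_ge0 ?sqr_ge0// mulr_ge0// ltW.
have yrho : rho <= y by apply: srho; rewrite -(mem_sort <=%R) E mem_head.
have y0 : 0 < y by exact: lt_le_trans yrho.
move=> pyt; rewrite big_cons lerD//.
  by rewrite lef_pV2 ?posrE ?exprn_gt0// lerXn2r// nnegrE ltW.
apply: le_trans (sum_inv_sqr_path y0 pyt) _.
by rewrite lef_pV2 ?posrE ?mulr_gt0// ler_pM2l.
Qed.

Lemma sum_inv_sqr rho s : 0 < rho -> uniq s -> separated delta s ->
  {in s, forall y, rho <= `|y|} ->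
  \sum_(y <- s) (y ^+ 2)^-1 <= 2 * ((rho ^+ 2)^-1 + (delta * rho)^-1).
Proof.
move=> rho0 us seps srho; rewrite (bigID (fun y => 0 <= y)) /= mulr_natl mulr2n.
apply: lerD.
  rewrite -big_filter; apply: sum_inv_sqr_pos; rewrite ?filter_uniq//.
    move=> a b; rewrite !mem_filter => /andP[_ sa] /andP[_ sb]; exact: seps.
  by move=> y; rewrite mem_filter => /andP[y0 /srho]; rewrite ger0_norm.
rewrite -big_filter.
pose t := [seq - y | y <- s & ~~ (0 <= y)].
have -> : \sum_(y <- [seq y <- s | ~~ (0 <= y)]) (y ^+ 2)^-1 =
    \sum_(y <- t) (y ^+ 2)^-1.
  by rewrite big_map; apply: eq_bigr => y _; rewrite sqrrN.
apply: sum_inv_sqr_pos => //.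
- by rewrite map_inj_uniq ?filter_uniq//; exact: oppr_inj.
- move=> _ _ /mapP[a + ->] /mapP[b + ->]; rewrite !mem_filter.
  move=> /andP[_ sa] /andP[_ sb]; rewrite (inj_eq oppr_inj) => ab.
  by rewrite -opprD normrN; exact: seps.
- move=> _ /mapP[a + ->]; rewrite mem_filter -ltNge => /andP[a0 /srho].
  by rewrite ltr0_norm.
Qed.

Lemma sum_averaged_kernel (M x : R) s : 0 <= M -> uniq s -> separated delta s ->
  x \in s ->
  \sum_(y <- s) averaged_kernel M (x - y) <= 2 * (M + 1) + 16 / delta ^+ 2.
Proof.
move=> M0 us seps xs; rewrite (bigD1_seq x)//= subrr.
rewrite {1}/averaged_kernel eqxx lerD2l.
have -> : \sum_(y <- s | y != x) averaged_kernel M (x - y) =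
    4 * \sum_(y <- [seq y - x | y <- s & y != x]) (y ^+ 2)^-1.
  rewrite big_map big_filter mulr_sumr; apply: eq_bigr => y yx.
  rewrite /averaged_kernel subr_eq0 eq_sym (negbTE yx).
  by rewrite -[x - y]opprB sqrrN.
apply: (@le_trans _ _ (4 * (2 * ((delta ^+ 2)^-1 + (delta * delta)^-1)))).
  rewrite ler_pM2l//; apply: sum_inv_sqr => //.
  - by rewrite map_inj_uniq ?filter_uniq//; exact: addIr.
  - move=> _ _ /mapP[a + ->] /mapP[b + ->]; rewrite !mem_filter.
    move=> /andP[_ sa] /andP[_ sb]; rewrite (inj_eq (addIr _)) => ab.
    have -> : a - x - (b - x) = a - b by ring.
    exact: seps.
  - move=> _ /mapP[a + ->]; rewrite mem_filter => /andP[ax sa].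
    exact: seps.
by rewrite le_eqVlt; apply/orP; left; apply/eqP; field; rewrite gt_eqF.
Qed.

End separated_sums.

Section fourier_tail.
Context (R : realType).
Implicit Types (s : seq (R * R)) (D E K : set R).
Local Notation mu := (@lebesgue_measure R).

Lemma cosint_setU D E (w th : R) : bounded_measurable (D `|` E) ->
  measurable D -> measurable E ->
  cosint (D `|` E) w th = cosint D w th + cosint E w th - cosint (E `&` D) w th.
Proof.
move=> bDE mD mE; have c := @continuous_cos_affine R w th.
have mED : measurable (E `\` D) by exact: measurableD.
have mEID : measurable (E `&` D) by exact: measurableI.
have UE : D `|` E = D `|` (E `\` D) by rewrite setDE setUIr setUv setIT.
rewrite /cosint {1}UE integ_setU //; last 2 first.
  by rewrite -UE.
  by rewrite setDIK.
have -> : integ E (fun t => cos (w * t + th)) =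
    integ (E `\` D) (fun t => cos (w * t + th)) +
    integ (E `&` D) (fun t => cos (w * t + th)).
  rewrite -{1}(setUIDK E D) setUC integ_setU //.
    by rewrite setUC setUIDK; apply: bounded_measurableS bDE _ _; [exact: mE|exact: subsetUr].
  by rewrite setDE setIACA setICl setI0.
ring.
Qed.

Lemma segmentI (a b c d : R) :
  `[a, b] `&` `[c, d] = `[Num.max a c, Num.min b d]%classic.
Proof.
apply/seteqP; split => t /=; rewrite !in_itv /= ge_max le_min.
  by move=> [/andP[-> ->] /andP[-> ->]].
by move=> /andP[/andP[-> ->] /andP[-> ->]].
Qed.

Definition segments s : set R :=
  \big[setU/set0]_(p <- s) `[p.1, p.2]%classic.

Lemma measurable_segments s : measurable (segments s).
Proof.
rewrite /segments; by elim/big_ind: _ => // A B mA mB; exact: measurableU.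
Qed.

(** Induction on the list of segments by inclusion-exclusion.  Intersecting with
    an arbitrary segment makes the induction work: the correction term is again
    the intersection of the shorter union with a segment. *)
Lemma cosint_segments s : exists2 c : R, 0 <= c &
  forall a b w th : R, w != 0 ->
    `|cosint (segments s `&` `[a, b]) w th| <= c / `|w|.
Proof.
elim: s => [|[u v] s [c c0 IH]].
  exists 0 => // a b w th _; rewrite /segments big_nil set0I.
  by rewrite /cosint Rintegral_set0 normr0 mul0r.
exists (2 + c + c) => [|a b w th w0]; first by rewrite !addr_ge0.
have mI (x y : R) : measurable (`[x, y]%classic : set R) by exact: measurable_itv.
have -> : segments ((u, v) :: s) `&` `[a, b] =
    `[Num.max u a, Num.min v b] `|` (segments s `&` `[a, b]).
  by rewrite /segments big_cons setIUl segmentI.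
have mS := measurable_segments s.
rewrite cosint_setU //; last 2 first.
- apply: bounded_measurableS (bounded_measurable_itv a b) _ _.
    by apply: measurableU => //; exact: measurableI.
  by rewrite -segmentI -setIUl; exact: subIsetr.
- exact: measurableI.
rewrite -setIA [_ `&` `[Num.max _ _, _]]segmentI.
have -> : (2 + c + c) / `|w| = 2 / `|w| + c / `|w| + c / `|w| by ring.
apply: le_trans (ler_normB _ _) _; apply: lerD; last exact: IH.
apply: le_trans (ler_normD _ _) _; apply: lerD; last exact: IH.
exact: norm_integ_cos_itv.
Qed.

Lemma compact_segments K (eps : R) : compact K -> 0 < eps ->
  exists2 s, K `<=` segments s & (mu (segments s `\` K) < eps%:E)%E.
Proof.
move=> cK eps0; have mK : measurable K by exact: compact_measurable.
have Kfin : (mu K < +oo)%E by exact: compact_finite_measure.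
have [V [oV KV mV]] := lebesgue_regularity_outer mK Kfin eps0.
move: cK; rewrite compact_cover => /(_ _
  [set p : R * R | `[p.1, p.2]%classic `<=` V] (fun p => `]p.1, p.2[%classic)).
case=> [p _||F FV KF].
- exact: interval_open.
- move=> x Kx; have /nbhs_ballP[e /= e0 eV] : nbhs x V.
    by apply: open_nbhs_nbhs; split => //; exact: KV.
  exists (x - e / 2, x + e / 2) => /=.
    move=> t /=; rewrite in_itv /= => /andP[t1 t2]; apply: eV.
    by rewrite /ball /= ltr_distlC; apply/andP; split; lra.
  by rewrite in_itv /=; apply/andP; split; lra.
exists (F : seq _).
  move=> x /KF[p /= pF]; rewrite in_itv /= => /andP[x1 x2].
  rewrite /segments (big_rem p)//=; left.
  by rewrite /= in_itv /= !ltW.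
apply: le_lt_trans mV; apply: le_measure; rewrite ?inE.
- by apply: measurableD => //; exact: measurable_segments.
- by apply: measurableD => //; exact: open_measurable.
apply: setSD; rewrite /segments big_seq.
elim/big_ind: _ => // [A B AV BV|p pF]; first by rewrite subUset.
by have := FV _ pF; rewrite inE.
Qed.

(** K is the difference of U, a finite union of segments, and of a set D of
    measure at most kappa / (4 B), where B is the Bessel constant.  The part of D
    is at most kappa / 4 whatever rho is, and the part of U is O(1 / rho). *)
Lemma fourier_tail K (M delta kappa : R) : compact K -> K `<=` `[- M, M] ->
  0 <= M -> 0 < delta -> 0 < kappa ->
  exists2 rho : R, 0 < rho &
    forall (F : {fset R}) (th : R), separated delta F ->
      {in F, forall l, rho <= `|l|} ->
      \sum_(l <- F) cosint K l th ^+ 2 <= kappa.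
Proof.
move=> cK KM M0 delta0 kappa0.
pose B := 2 * (M + 1) + 16 / delta ^+ 2.
have B0 : 0 < B.
  by rewrite ltr_pwDl ?mulr_gt0 ?ltr_wpDl// divr_ge0// sqr_ge0.
have eps0 : 0 < kappa / (4 * B) by rewrite divr_gt0// mulr_gt0.
have [s Ks sK] := compact_segments cK eps0.
have [c c0 cP] := cosint_segments s.
(* With rho >= 1, the tail of U is at most 2 c ^ 2 (1 + 1 / delta) / rho. *)
pose rho := 1 + 8 * c ^+ 2 * (1 + delta^-1) / kappa.
have rho1 : 1 <= rho.
  by rewrite lerDl divr_ge0 ?mulr_ge0 ?sqr_ge0 ?addr_ge0 ?invr_ge0// ltW.
have rho0 : 0 < rho by lra.
exists rho => // F th Fsep Frho.
pose U := segments s `&` `[- M, M]; pose D := U `\` K.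
have mK : measurable K by exact: compact_measurable.
have mU : measurable U.
  by apply: measurableI; [exact: measurable_segments|exact: measurable_itv].
have mD : measurable D by exact: measurableD.
have UM : U `<=` `[- M, M] by exact: subIsetr.
have DM : D `<=` `[- M, M] by move=> t [/UM].
have bM := bounded_measurable_itv (- M) M.
have bU := bounded_measurableS bM mU UM.
have bD := bounded_measurableS bM mD DM.
have KU : K `<=` U by move=> t Kt; split; [exact: Ks|exact: KM].
have KDU : K `|` D = U by rewrite /D setDUK.
have KE w : cosint K w th = cosint U w th - cosint D w th.
  rewrite -KDU cosint_setU ?KDU// (_ : D `&` K = set0); last first.
    by rewrite /D setDE -setIA setICl setI0.
  by rewrite [cosint set0 _ _]Rintegral_set0; ring.
have lebD : B * leb D <= kappa / 4.
  have : leb D <= kappa / (4 * B).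
    rewrite -lee_fin fineK ?bounded_measurable_fin//.
    apply: le_trans (ltW sK); apply: le_measure; rewrite ?inE//.
      by apply: measurableD => //; exact: measurable_segments.
    by apply: setSD; exact: subIsetl.
  move=> h; apply: (le_trans (ler_wpM2l (ltW B0) h)).
  by rewrite le_eqVlt; apply/orP; left; apply/eqP; field; rewrite gt_eqF.
have sumD : \sum_(l <- F) cosint D l th ^+ 2 <= kappa / 4.
  apply: le_trans lebD; rewrite big_seq_fsetE /=.
  apply: (@bessel R F M B D (fun l => val l) (fun=> th)) => // i.
  rewrite -(@big_seq_fsetE _ _ _ _ F xpredT
    (fun l => averaged_kernel M (val i - l))) /=.
  exact: (sum_averaged_kernel delta0 M0 (fset_uniq F) Fsep (valP i)).
have sumU : \sum_(l <- F) cosint U l th ^+ 2 <= kappa / 4.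
  apply: (@le_trans _ _ (c ^+ 2 * \sum_(l <- F) (l ^+ 2)^-1)).
    rewrite mulr_sumr !big_seq; apply: ler_sum => l lF.
    have l0 : l != 0.
      by apply/eqP => l0; have := Frho l lF; rewrite l0 normr0; lra.
    have := cP (- M) M l th l0 => cl.
    have : `|cosint U l th| ^+ 2 <= (c / `|l|) ^+ 2.
      by rewrite ler_pXn2r// nnegrE divr_ge0.
    by rewrite expr_div_n !real_normK ?num_real.
  apply: (@le_trans _ _ (c ^+ 2 * (2 * ((rho ^+ 2)^-1 + (delta * rho)^-1)))).
    by rewrite ler_wpM2l ?sqr_ge0//; exact: (sum_inv_sqr delta0 rho0 (fset_uniq F)).
  apply: (@le_trans _ _ (c ^+ 2 * (2 * (rho^-1 + (delta * rho)^-1)))).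
    rewrite ler_wpM2l ?sqr_ge0// ler_pM2l// lerD2r lef_pV2 ?posrE ?exprn_gt0//.
    by rewrite ler_eXnr.
  have -> : c ^+ 2 * (2 * (rho^-1 + (delta * rho)^-1)) =
      (2 * c ^+ 2 * (1 + delta^-1)) / rho.
    by field; rewrite !gt_eqF.
  rewrite ler_pdivrMr// /rho.
  have -> : kappa / 4 * (1 + 8 * c ^+ 2 * (1 + delta^-1) / kappa) =
      kappa / 4 + 2 * c ^+ 2 * (1 + delta^-1).
    by field; rewrite !gt_eqF.
  by rewrite lerDr divr_ge0// ltW.
apply: (@le_trans _ _ (2 * \sum_(l <- F) cosint U l th ^+ 2 +
                       2 * \sum_(l <- F) cosint D l th ^+ 2)); last by lra.
rewrite !mulr_sumr -big_split /=; apply: ler_sum => l _; rewrite KE.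
set x := cosint U l th; set y := cosint D l th.
rewrite -subr_ge0.
have -> : 2 * x ^+ 2 + 2 * y ^+ 2 - (x - y) ^+ 2 = (x + y) ^+ 2 by ring.
exact: sqr_ge0.
Qed.

End fourier_tail.

(** * Gram matrix of the grid and its approximation *)

Section approximate_gram.
Context (R : realType).
Implicit Types (K : set R) (w t th : R) (al be : R -> R) (F : seq R).

(** The square modulus of e_w - sum (al l + i be l) e_l at t.  The frequency w is
    angular, whereas the frequencies l are multiplied by 2 pi. *)
Definition residual F al be w t : R :=
  (cos (w * t) - \sum_(l <- F) (al l * cos (2 * pi * l * t) -
                                be l * sin (2 * pi * l * t))) ^+ 2 +
  (sin (w * t) - \sum_(l <- F) (al l * sin (2 * pi * l * t) +
                                be l * cos (2 * pi * l * t))) ^+ 2.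

Definition quarter_turn (b : bool) : R := if b then pi / 2 else 0.

(** The coefficients of al + i be (b = false) and of i (al + i be) (b = true) on
    the phases 0 (b' = false) and pi / 2 (b' = true). *)
Definition rotate al be (b b' : bool) (l : R) : R :=
  if b == b' then al l else if b' then be l else - be l.

Lemma sum_rotate_sqr al be b l :
  \sum_b' rotate al be b b' l ^+ 2 = al l ^+ 2 + be l ^+ 2.
Proof. by rewrite big_bool /rotate; case: b => /=; rewrite ?sqrrN // addrC. Qed.

Lemma residual_rotate F al be (w t : R) b : residual F al be w t =
  (cos (w * t + quarter_turn b) - \sum_(l <- F) \sum_b'
     rotate al be b b' l * cos (2 * pi * l * t + quarter_turn b')) ^+ 2 +
  (sin (w * t + quarter_turn b) - \sum_(l <- F) \sum_b'
     rotate al be b b' l * sin (2 * pi * l * t + quarter_turn b')) ^+ 2.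
Proof.
have sumE (f g : R -> R) : (forall l, f l = g l) ->
    \sum_(l <- F) f l = \sum_(l <- F) g l.
  by move=> fg; apply: eq_bigr.
case: b; rewrite /residual /quarter_turn /rotate ?addr0.
  rewrite cosDpihalf sinDpihalf addrC -[in LHS]sqrrN; congr (_ ^+ 2 + _ ^+ 2).
    rewrite opprB addrC; congr (_ + _); rewrite -[LHS]opprK -sumrN; congr (- _).
    apply: sumE => l.
    by rewrite big_bool /= addr0 cosDpihalf; ring.
  congr (_ - _); apply: sumE => l.
  by rewrite big_bool /= addr0 sinDpihalf; ring.
congr ((_ - _) ^+ 2 + (_ - _) ^+ 2); apply: sumE => l;
  by rewrite big_bool /= addr0 ?cosDpihalf ?sinDpihalf; ring.
Qed.

Lemma continuous_residual F al be w : continuous (residual F al be w).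
Proof.
pose f t := cos (w * t + quarter_turn false) - \sum_(l <- F) \sum_b'
     rotate al be false b' l * cos (2 * pi * l * t + quarter_turn b').
pose g t := sin (w * t + quarter_turn false) - \sum_(l <- F) \sum_b'
     rotate al be false b' l * sin (2 * pi * l * t + quarter_turn b').
have cf : continuous f.
  move=> t; apply: cvgB; first exact: continuous_cos_affine.
  by do 2!(apply: continuous_sum => ?); exact: continuous_scale_cos.
have cg : continuous g.
  move=> t; apply: cvgB; first exact: continuous_sin_affine.
  by do 2!(apply: continuous_sum => ?); exact: continuous_scale_sin.
have -> : residual F al be w = (fun t => f t ^+ 2 + g t ^+ 2).
  by apply/funext => t; exact: residual_rotate.
by move=> t; apply: cvgD; exact: continuous_sqr.
Qed.

(** The error is the integral over K of the scalar product of the residual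
    function with a function of modulus 1.  Its absolute value is at most
    s / 2 + residual / (2 s) pointwise. *)
Lemma cosint_approx K F al be (w a th s eta : R) b :
  bounded_measurable K -> 0 < s -> integ K (residual F al be w) <= eta ->
  `|cosint K (a - w) (th - quarter_turn b) - \sum_(l <- F) \sum_b'
      rotate al be b b' l * cosint K (a - 2 * pi * l) (th - quarter_turn b')| <=
  (s * leb K + eta / s) / 2.
Proof.
move=> bK s0 Keta.
pose PR t := cos (w * t + quarter_turn b) - \sum_(l <- F) \sum_b'
     rotate al be b b' l * cos (2 * pi * l * t + quarter_turn b').
pose PI t := sin (w * t + quarter_turn b) - \sum_(l <- F) \sum_b'
     rotate al be b b' l * sin (2 * pi * l * t + quarter_turn b').
pose d t := cos (a * t + th) * PR t + sin (a * t + th) * PI t.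
have dE t : d t = cos ((a - w) * t + (th - quarter_turn b)) -
    \sum_(l <- F) \sum_b' rotate al be b b' l *
      cos ((a - 2 * pi * l) * t + (th - quarter_turn b')).
  have cosE u v : cos ((a - u) * t + (th - v)) =
     cos (a * t + th) * cos (u * t + v) + sin (a * t + th) * sin (u * t + v).
    by rewrite -cosB; congr cos; ring.
  rewrite /d /PR /PI !mulrBr cosE addrACA; congr (_ + _).
  rewrite -opprD !mulr_sumr -big_split /=; congr (- _); apply: eq_bigr => l _.
  rewrite !mulr_sumr -big_split /=; apply: eq_bigr => b' _.
  by rewrite cosE; ring.
have cterm l b' : continuous (fun t => rotate al be b b' l *
    cos ((a - 2 * pi * l) * t + (th - quarter_turn b'))).
  exact: continuous_scale_cos.
have csum : continuous (fun t => \sum_(l <- F) \sum_b' rotate al be b b' l *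
    cos ((a - 2 * pi * l) * t + (th - quarter_turn b'))).
  by do 2!(apply: continuous_sum => ?); exact: cterm.
have cd : continuous d.
  rewrite (funext dE) => t; apply: cvgD; first exact: continuous_cos_affine.
  by apply: cvgN; exact: csum.
have -> : cosint K (a - w) (th - quarter_turn b) - \sum_(l <- F) \sum_b'
    rotate al be b b' l * cosint K (a - 2 * pi * l) (th - quarter_turn b') =
    integ K d.
  rewrite (funext dE) integD //; last 2 first.
    exact: continuous_cos_affine.
    by move=> t; apply: cvgN; exact: csum.
  congr (_ + _).
  under [RHS]eq_Rintegral do rewrite -mulN1r.
  rewrite integZ// mulN1r integ_sum// => [|l]; last first.
    by apply: continuous_sum => b'; exact: cterm.
  congr (- _); apply: eq_bigr => l _; rewrite integ_sum//.
  apply: eq_bigr => b' _; rewrite integZ//; exact: continuous_cos_affine.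
apply: (@le_trans _ _ (integ K (fun t => s / 2 +
    (2 * s)^-1 * residual F al be w t))).
  have cr : continuous (fun t => s / 2 + (2 * s)^-1 * residual F al be w t).
    move=> t; apply: cvgD; first exact: cvg_cst.
    by apply: cvgM; [exact: cvg_cst|exact: continuous_residual].
  apply: le_trans (le_normr_Rintegral _ _) _; first exact: bK.1.
    exact: continuous_integrable.
  apply: le_integ => //.
    by move=> t; apply: cvg_norm; exact: cd.
  move=> t _; rewrite (residual_rotate _ _ _ _ _ b) -/(PR t) -/(PI t).
  have d2 : d t ^+ 2 <= PR t ^+ 2 + PI t ^+ 2.
    rewrite -subr_ge0 -[X in X - _]mul1r -(cos2Dsin2 (a * t + th)).
    have -> : (cos (a * t + th) ^+ 2 + sin (a * t + th) ^+ 2) *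
        (PR t ^+ 2 + PI t ^+ 2) - d t ^+ 2 =
        (cos (a * t + th) * PI t - sin (a * t + th) * PR t) ^+ 2.
      by rewrite /d; ring.
    exact: sqr_ge0.
  apply: (@le_trans _ _ (s / 2 + (2 * s)^-1 * d t ^+ 2)).
    rewrite -[d t ^+ 2]real_normK ?num_real// -subr_ge0.
    have -> : s / 2 + (2 * s)^-1 * `|d t| ^+ 2 - `|d t| =
        (2 * s)^-1 * (`|d t| - s) ^+ 2 by field; rewrite gt_eqF.
    by rewrite mulr_ge0 ?sqr_ge0// invr_ge0 mulr_ge0// ltW.
  by rewrite lerD2l ler_wpM2l// invr_ge0 mulr_ge0// ltW.
rewrite integD//; last 2 first.
  by move=> t; exact: cvg_cst.
  by move=> t; apply: cvgM; [exact: cvg_cst|exact: continuous_residual].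
rewrite integ_cst// integZ//; last exact: continuous_residual.
have -> : (s * leb K + eta / s) / 2 = s / 2 * leb K + (2 * s)^-1 * eta.
  by field; rewrite gt_eqF.
by rewrite lerD2l ler_wpM2l// invr_ge0 mulr_ge0// ltW.
Qed.

End approximate_gram.

Section grid.
Context (R : realType) (M : R) (M_gt0 : 0 < M) (m : nat) (v : R).

Definition grid_freq (k : 'I_m) : R := v + k%:R / (2 * M).

Lemma sin_natpi (n : nat) : sin (n%:R * pi) = 0 :> R.
Proof.
elim: n => [|n IH]; first by rewrite mul0r sin0.
by rewrite -natr1 mulrDl mul1r sinDpi IH oppr0.
Qed.

(** For distinct grid points the angular frequency w of the difference is an
    integer multiple of pi / M, so that sin (w M) = 0. *)
Lemma cosint_grid (i j : 'I_m * bool) :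
  cosint `[- M, M] (2 * pi * grid_freq i.1 - 2 * pi * grid_freq j.1)
    (quarter_turn R i.2 - quarter_turn R j.2) = if i == j then 2 * M else 0.
Proof.
have Mn0 : M != 0 by rewrite gt_eqF.
have pin0 : pi != 0 :> R by rewrite gt_eqF// pi_gt0.
case: i j => [k b] [l c] /=; rewrite cosint_centered; last exact: ltW.
have [kl|kl] := eqVneq k l.
  rewrite kl subrr eqxx; case: (eqVneq (l, b) (l, c)) => [[->]|bc].
    by rewrite subrr cos0 mulr1.
  suff -> : cos (quarter_turn R b - quarter_turn R c) = 0 by rewrite mulr0.
  by move: bc; case: b; case: c; rewrite ?eqxx//= /quarter_turn ?subr0 ?sub0r ?cosN;
     rewrite cos_pihalf.
have kl' : ((k, b) == (l, c)) = false.
  by apply/negbTE; apply: contraNneq kl => -[-> _].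
rewrite kl'; case: ifPn => [|_].
  rewrite subr_eq0 => /eqP; rewrite /grid_freq => h.
  have : k%:R = l%:R :> R.
    apply: (mulIf (x := pi / M)); first by rewrite mulf_neq0// invr_eq0.
    apply: (addrI (2 * pi * v)).
    have E (u : R) : 2 * pi * v + u * (pi / M) = 2 * pi * (v + u / (2 * M)).
      by field.
    by rewrite !E.
  by move=> /eqP; rewrite eqr_nat => /eqP /val_inj E; rewrite E eqxx in kl.
rewrite cosBpihalf.
have -> : (2 * pi * grid_freq k - 2 * pi * grid_freq l) * M =
    k%:R * pi - l%:R * pi.
  by rewrite /grid_freq; field.
by rewrite sinB !sin_natpi mul0r mulr0 subr0 mulr0.
Qed.

Lemma gram_le (K : set R) (x : 'I_m * bool -> R) : measurable K ->
  K `<=` `[- M, M] ->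
  \sum_i \sum_j x i * x j *
    (cosint K (2 * pi * grid_freq i.1 - 2 * pi * grid_freq j.1)
       (quarter_turn R i.2 - quarter_turn R j.2) / (2 * M)) <= \sum_i x i ^+ 2.
Proof.
move=> mK KM; have bM := bounded_measurable_itv (- M) M.
have bK := bounded_measurableS bM mK KM.
have M2 : 0 < 2 * M by rewrite mulr_gt0.
pose a (i : 'I_m * bool) := 2 * pi * grid_freq i.1.
pose th (i : 'I_m * bool) := quarter_turn R i.2.
have -> : \sum_i \sum_j x i * x j * (cosint K (2 * pi * grid_freq i.1 -
      2 * pi * grid_freq j.1) (quarter_turn R i.2 - quarter_turn R j.2) / (2 * M)) =
    integ K (energy x a th) / (2 * M).
  rewrite integ_energy// mulr_suml; apply: eq_bigr => i _.
  by rewrite mulr_suml; apply: eq_bigr => j _; rewrite mulrA.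
rewrite ler_pdivrMr//.
apply: (@le_trans _ _ (integ `[- M, M] (energy x a th))).
  apply: le_integ_set => //; first exact: continuous_energy.
  by move=> t; rewrite addr_ge0 ?sqr_ge0.
rewrite integ_energy// mulr_suml le_eqVlt; apply/orP; left; apply/eqP.
apply: eq_bigr => i _; rewrite (bigD1 i)//= big1 => [|j ji].
  by rewrite cosint_grid eqxx expr2 addr0.
by rewrite cosint_grid eq_sym (negbTE ji) mulr0.
Qed.

Lemma sum_grid_const (c : R) : \sum_(i : 'I_m * bool) c = 2 * m%:R * c.
Proof.
by rewrite sumr_const card_prod card_ord card_bool -[LHS]mulr_natl natrM [m%:R * _]mulrC.
Qed.

Lemma gram_trace (K : set R) : bounded_measurable K ->
  \sum_(i : 'I_m * bool)
    cosint K (2 * pi * grid_freq i.1 - 2 * pi * grid_freq i.1)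
       (quarter_turn R i.2 - quarter_turn R i.2) / (2 * M) =
  2 * m%:R * (leb K / (2 * M)).
Proof.
move=> bK; rewrite (eq_bigr (fun=> leb K / (2 * M))) => [|i _].
  exact: sum_grid_const.
rewrite !subrr /cosint; under eq_Rintegral do rewrite mul0r addr0 cos0.
by rewrite integ_cst// mul1r.
Qed.

End grid.

(** * Counting frequencies in a window *)

(** Uniform completeness on K, with the real and imaginary parts of the
    coefficients separated. *)
Definition real_uniformly_complete (R : realType) (L K : set R) (C : R) : Prop :=
  forall w eta : R, 0 < eta -> exists (F : {fset R}) (al be : R -> R),
    [/\ [set` F] `<=` L, \sum_(l <- F) (al l ^+ 2 + be l ^+ 2) <= C &
        integ K (residual F al be (2 * pi * w)) <= eta].

(** Finitely many approximations can use the same set of frequencies: extend the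
    coefficients by zero. *)
Lemma common_support (R : realType) (L K : set R) (C eta : R) (I : finType)
  (w : I -> R) : real_uniformly_complete L K C -> 0 < eta ->
  exists (U : {fset R}) (al be : I -> R -> R), [set` U] `<=` L /\
    forall i, \sum_(l <- U) (al i l ^+ 2 + be i l ^+ 2) <= C /\
      integ K (residual U (al i) (be i) (2 * pi * w i)) <= eta.
Proof.
move=> uc eta0.
have /choice[p pP] : forall i : I, exists p : {fset R} * (R -> R) * (R -> R),
    [/\ [set` p.1.1] `<=` L,
        \sum_(l <- p.1.1) (p.1.2 l ^+ 2 + p.2 l ^+ 2) <= C &
        integ K (residual p.1.1 p.1.2 p.2 (2 * pi * w i)) <= eta].
  by move=> i; have [F [al [be H]]] := uc (w i) eta eta0; exists (F, al, be).
pose U := (\bigcup_(i <- enum I) (p i).1.1)%fset.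
pose al i l := if l \in (p i).1.1 then (p i).1.2 l else 0.
pose be i l := if l \in (p i).1.1 then (p i).2 l else 0.
have sumU i (f g : R -> R) : {in (p i).1.1, f =1 g} ->
    (forall l, l \notin (p i).1.1 -> g l = 0) ->
    \sum_(l <- U) g l = \sum_(l <- (p i).1.1) f l.
  move=> fg g0; rewrite -(@big_fset_incl _ _ _ _ (p i).1.1).
  - by rewrite big_seq [RHS]big_seq; apply: eq_bigr => l /fg.
  - by apply: bigfcup_sup => //; rewrite mem_enum.
  - by move=> l _ /g0.
have alE i l : l \in (p i).1.1 -> al i l = (p i).1.2 l by rewrite /al => ->.
have beE i l : l \in (p i).1.1 -> be i l = (p i).2 l by rewrite /be => ->.
have al0 i l : l \notin (p i).1.1 -> al i l = 0 by rewrite /al => /negbTE ->.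
have be0 i l : l \notin (p i).1.1 -> be i l = 0 by rewrite /be => /negbTE ->.
exists U, al, be; split.
  move=> l /= /bigfcupP[i _ lp]; have [+ _ _] := pP i.
  exact.
move=> i; have [_ pC pK] := pP i; split.
  rewrite (sumU i (fun l => (p i).1.2 l ^+ 2 + (p i).2 l ^+ 2))// => l lp.
    by rewrite alE// beE.
  by rewrite al0// be0// expr0n addr0.
rewrite (_ : residual U _ _ _ =
  residual (p i).1.1 (p i).1.2 (p i).2 (2 * pi * w i))//.
apply/funext => t; rewrite /residual.
congr ((_ - _) ^+ 2 + (_ - _) ^+ 2); apply: sumU => l lp.
- by rewrite alE// beE.
- by rewrite al0// be0// !mul0r subr0.
- by rewrite alE// beE.
- by rewrite al0// be0// !mul0r addr0.
Qed.

Lemma sum_fset_bool (R : realType) (V : {fset R}) (f : R -> bool -> R) :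
  \sum_(z : V * bool) f (val z.1) z.2 = \sum_(l <- V) \sum_b f l b.
Proof.
rewrite big_seq_fsetE /= -(pair_big xpredT xpredT (fun l b => f (val l) b)).
by [].
Qed.

(** The trace inequality for the rows and columns indexed by the grid and the two
    phases.  The block B X collects the frequencies of the window; A Y collects
    the other frequencies and the errors of approximation, the latter multiplied
    by the identity matrix.  Rows of A have square norm at most
    3 kappa / (2 M) ^ 2, one third for each phase and one third for the errors;
    columns of Y have square norm at most C + 1.  The weight s balances the two,
    and kappa is chosen to make the total 2 m eps. *)
Lemma grid_count (R : realType) (L K : set R) (M delta C eps : R) :
  compact K -> K `<=` `[- M, M] -> 0 < M -> 0 < delta -> 0 <= C -> 0 < eps ->
  (forall l g : R, L l -> L g -> l != g -> delta <= `|l - g|) ->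
  real_uniformly_complete L K C ->
  exists2 rho : R, 0 < rho &
    forall (x r : R) (m : nat) (Z : {fset R}),
    (forall k : 'I_m, 2 * rho + k%:R / (2 * M) <= r) ->
    (forall l, L l -> x <= l <= x + r -> l \in Z) ->
    m%:R * (leb K / (2 * M) - eps) <= #|` Z|%:R.
Proof.
move=> cK KM M0 delta0 C0 eps0 Lsep uc.
have pi0 : 0 < pi :> R by exact: pi_gt0.
have pi20 : 0 < 2 * pi :> R by rewrite mulr_gt0.
have N0 : 0 < 2 * M by rewrite mulr_gt0.
pose s := (C + 1) / eps.
have s0 : 0 < s by rewrite divr_gt0// ltr_wpDl.
pose kappa := eps * (2 * M) ^+ 2 / (3 * s).
have kappa0 : 0 < kappa.
  by apply: divr_gt0; apply: mulr_gt0 => //; exact: exprn_gt0.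
have [rho' rho'0 tail] := fourier_tail cK KM (ltW M0) (mulr_gt0 pi20 delta0) kappa0.
(* rho' bounds angular frequencies, rho the elements of L. *)
exists (rho' / (2 * pi)) => [|x r m Z mr LZ]; first by rewrite divr_gt0.
set rho := rho' / (2 * pi) in mr *.
have rho0 : 0 < rho by rewrite divr_gt0.
have [->|m0] := eqVneq m 0%N; first by rewrite mul0r.
have mgt0 : 0 < m%:R :> R by rewrite ltr0n lt0n.
have bM := bounded_measurable_itv (- M) M.
have mK : measurable K by exact: compact_measurable.
have bK := bounded_measurableS bM mK KM.
have K0 : 0 <= leb K by rewrite fine_ge0.
pose g := @grid_freq R M m (x + rho).
(* Each row of the error block has 2m entries, so that the squares of entries
   of size tau add up to at most kappaN. *)
pose kappaN := kappa / (2 * M) ^+ 2.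
have kappaN0 : 0 < kappaN by rewrite divr_gt0// exprn_gt0.
pose tau := Num.min 1 (kappaN / (2 * m%:R)).
have tau0 : 0 < tau by rewrite lt_min ltr01 divr_gt0// mulr_gt0.
have tau2 : 2 * m%:R * tau ^+ 2 <= kappaN.
  have tau1 : tau <= 1 by rewrite ge_min lexx.
  have : tau <= kappaN / (2 * m%:R) by rewrite ge_min lexx orbT.
  rewrite ler_pdivlMr ?mulr_gt0// mulrC => h; apply: le_trans h.
  by rewrite ler_wpM2l ?mulr_ge0// expr2 ler_piMr// ltW.
(* For s = sg and eta = sg ^ 2 the bound of cosint_approx is 2 M tau. *)
pose sg := 2 * tau * (2 * M) / (leb K + 1).
have sg0 : 0 < sg by rewrite divr_gt0 ?mulr_gt0// ltr_wpDl.
have [U [al [be [UL UP]]]] := common_support g uc (exprn_gt0 2 sg0).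
pose near l := x <= l <= x + r.
pose V := [fset l in U | near l]%fset; pose W := [fset l in U | ~~ near l]%fset.
pose I := ('I_m * bool)%type.
pose entry (i : I) l b :=
  cosint K (2 * pi * g i.1 - 2 * pi * l) (quarter_turn R i.2 - quarter_turn R b) / (2 * M).
pose coef (j : I) l b := rotate (al j.1) (be j.1) j.2 b l.
pose T (i j : I) := entry i (g j.1) j.2.
pose err (i j : I) := T i j - \sum_(l <- U) \sum_b entry i l b * coef j l b.
have errP i j : `|err i j| <= tau.
  have -> : err i j = (cosint K (2 * pi * g i.1 - 2 * pi * g j.1)
      (quarter_turn R i.2 - quarter_turn R j.2) - \sum_(l <- U) \sum_b coef j l b *
       cosint K (2 * pi * g i.1 - 2 * pi * l) (quarter_turn R i.2 - quarter_turn R b)) /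
       (2 * M).
    rewrite mulrBl; congr (_ - _); rewrite mulr_suml; apply: eq_bigr => l _.
    by rewrite mulr_suml; apply: eq_bigr => b _; rewrite /entry; ring.
  rewrite normrM (gtr0_norm (x := (2 * M)^-1)) ?invr_gt0// ler_pdivrMr//.
  have := cosint_approx (2 * pi * g i.1) (quarter_turn R i.2) j.2 bK sg0 (UP j.1).2.
  move/le_trans; apply; rewrite /sg le_eqVlt; apply/orP; left; apply/eqP.
  by field; rewrite !gt_eqF// ltr_wpDl.
pose B (i : I) (z : V * bool) := entry i (val z.1) z.2.
pose X (z : V * bool) (j : I) := coef j (val z.1) z.2.
pose A (i : I) (q : W * bool + I) := match q with
  | inl z => entry i (val z.1) z.2 | inr j => err i j end.
pose Y (q : W * bool + I) (j : I) : R := match q with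
  | inl z => coef j (val z.1) z.2 | inr i => (i == j)%:R end.
have TE i j : T i j = \sum_z B i z * X z j + \sum_q A i q * Y q j.
  rewrite big_sumType /= (sum_fset_bool V (fun l b => entry i l b * coef j l b)).
  rewrite (sum_fset_bool W (fun l b => entry i l b * coef j l b)) addrA.
  rewrite -(big_fsetID _ near U (fun l => \sum_b entry i l b * coef j l b)) /=.
  have -> : \sum_(k : I) err i k * (k == j)%:R = err i j.
    rewrite (bigD1 j)//= eqxx mulr1 big1 ?addr0// => k kj.
    by rewrite (negbTE kj) mulr0.
  by rewrite /err addrC subrK.
have Tle (y : I -> R) : \sum_i \sum_j y i * y j * T i j <= \sum_i y i ^+ 2.
  exact: gram_le.
have := trace_le_rank s0 TE Tle.
rewrite /T /entry gram_trace//.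
have -> : #|{: V * bool}|%:R = 2 * #|` V|%:R :> R.
  by rewrite card_prod card_bool -cardfE natrM mulrC.
have VZ : #|` V|%:R <= #|` Z|%:R :> R.
  rewrite ler_nat; apply: fsubset_leq_card; apply/fsubsetP => l.
  by rewrite !inE /= => /andP[lU nl]; apply: LZ => //; exact: UL.
have Ale : \sum_i \sum_j A i j ^+ 2 <= 2 * m%:R * (3 * kappa / (2 * M) ^+ 2).
  have row i : \sum_j A i j ^+ 2 <= 3 * kappa / (2 * M) ^+ 2.
    rewrite big_sumType /= (sum_fset_bool W (fun l b => entry i l b ^+ 2)).
    have -> : 3 * kappa / (2 * M) ^+ 2 = \sum_(b : bool) kappaN + kappaN.
      by rewrite big_bool /= -mulrA -/kappaN; ring.
    apply: lerD.
      rewrite exchange_big; apply: ler_sum => b _.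
      pose h l := 2 * pi * g i.1 - 2 * pi * l.
      have hI : injective h.
        by move=> l l' /addrI /oppr_inj /(mulfI (lt0r_neq0 pi20)).
      have hB l l' : h l - h l' = 2 * pi * (l' - l) by rewrite /h; ring.
      rewrite (eq_bigr (fun l => cosint K (h l) (quarter_turn R i.2 - quarter_turn R b) ^+ 2
        / (2 * M) ^+ 2)) => [|l _]; last by rewrite /entry expr_div_n.
      rewrite -mulr_suml ler_wpM2r ?invr_ge0 ?sqr_ge0//.
      have := tail [fset h l | l in W]%fset (quarter_turn R i.2 - quarter_turn R b).
      rewrite big_imfset/=; last by move=> ? ? _ _; exact: hI.
      apply.
        move=> _ _ /imfsetP[l /= lW ->] /imfsetP[l' /= l'W ->] ll'.
        rewrite hB normrM (gtr0_norm pi20) ler_pM2l// distrC; apply: Lsep.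
        - by apply: UL; move: lW; rewrite !inE => /andP[].
        - by apply: UL; move: l'W; rewrite !inE => /andP[].
        - by apply: contraNneq ll' => ->.
      move=> _ /imfsetP[l /= + ->]; rewrite !inE => /andP[_ nl].
      rewrite /h -mulrBr normrM (gtr0_norm pi20) mulrC -ler_pdivrMr// -/rho.
      have := mr i.1; rewrite /g /grid_freq; set q := _ / _ => qr.
      have q0 : 0 <= q by rewrite divr_ge0// ltW.
      move: nl; rewrite /near negb_and -!ltNge => /orP[lx|lx].
        by rewrite ger0_norm; lra.
      by rewrite ler0_norm; lra.
    apply: le_trans tau2.
    apply: (@le_trans _ _ (\sum_(j : I) tau ^+ 2)).
      apply: ler_sum => j _; rewrite -[leLHS]real_normK ?num_real//.
      by rewrite ler_pXn2r ?nnegrE// ltW.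
    by rewrite sum_grid_const.
  apply: (@le_trans _ _ (\sum_(i : I) 3 * kappa / (2 * M) ^+ 2)).
    by apply: ler_sum => i _; exact: row.
  by rewrite sum_grid_const.
have Yle : \sum_i \sum_j Y i j ^+ 2 <= 2 * m%:R * (C + 1).
  rewrite exchange_big /=.
  apply: (@le_trans _ _ (\sum_(i : I) (C + 1))).
    apply: ler_sum => j _; rewrite big_sumType /=.
    rewrite (sum_fset_bool W (fun l b => coef j l b ^+ 2)); apply: lerD.
      apply: le_trans (UP j.1).1.
      rewrite [leRHS](big_fsetID _ near) /= -/V -/W.
      apply: ler_wpDl; first by apply: sumr_ge0 => l _; rewrite addr_ge0 ?sqr_ge0.
      by apply: ler_sum => l _; rewrite sum_rotate_sqr.
    rewrite (bigD1 j)//= eqxx expr1n big1 ?addr0// => k kj.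
    by rewrite (negbTE kj) expr0n.
  by rewrite sum_grid_const.
move=> H.
have {}H : 2 * m%:R * (leb K / (2 * M)) <= 2 * #|` Z|%:R +
   (s * (2 * m%:R * (3 * kappa / (2 * M) ^+ 2)) + s^-1 * (2 * m%:R * (C + 1))) / 2.
  apply: (le_trans H); apply: lerD; first by rewrite ler_pM2l.
  by rewrite ler_pM2r ?invr_gt0//; apply: lerD; rewrite ler_pM2l ?invr_gt0.
have C1 : C + 1 != 0 by rewrite gt_eqF// ltr_wpDl.
have E : (s * (2 * m%:R * (3 * kappa / (2 * M) ^+ 2)) +
    s^-1 * (2 * m%:R * (C + 1))) / 2 = 2 * m%:R * eps.
  by rewrite /kappa /s; field; rewrite C1 !gt_eqF.
rewrite E in H; lra.
Qed.

(** * Existence of the lower density *)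

Section fekete.
Context (R : realType) (g : R -> R) (c : R).

Lemma superadditive_mul (s : R) (q : nat) (t : R) : 0 <= s -> 0 <= t ->
  (forall r s : R, 0 <= r -> 0 <= s -> g r + g s <= g (r + s)) ->
  q%:R * g s + g t <= g (q%:R * s + t).
Proof.
move=> s0 t0 gD; elim: q => [|q IH]; first by rewrite !mul0r !add0r.
rewrite -natr1 !mulrDl !mul1r.
have -> : q%:R * s + s + t = s + (q%:R * s + t) by ring.
have := gD s (q%:R * s + t) s0 (addr_ge0 (mulr_ge0 (ler0n _ _) s0) t0).
lra.
Qed.

(** The limit is the supremum of g s / s.  For r = q s + t with 0 <= t < s,
    superadditivity gives g r >= q g s - 1, which is r (g s / s) up to a constant
    that does not depend on r. *)
Lemma fekete : (forall r s : R, 0 <= r -> 0 <= s -> g r + g s <= g (r + s)) ->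
  (forall r, 0 <= r -> -1 <= g r) -> (forall r, 0 < r -> g r <= c * r) ->
  exists l : R, g r / r @[r --> +oo] --> l.
Proof.
move=> gD gN1 gc; pose E := [set g r / r | r in [set r : R | 0 < r]].
have supE : has_sup E.
  split; first by exists (g 1 / 1); exists 1 => /=.
  by exists c => _ [r /= r0 <-]; rewrite ler_pdivrMr// gc.
exists (sup E); apply/cvgrPdist_le => e e0.
have e20 : 0 < e / 2 by rewrite divr_gt0.
have [_ [s /= s0 <-] sE] := sup_adherent e20 supE.
have K0 : 0 < (`|g s| + 1) / (e / 2) by rewrite divr_gt0// ltr_wpDl.
near=> r.
have rK : (`|g s| + 1) / (e / 2) < r by near: r; apply: nbhs_pinfty_gt; exact: num_real.
have r0 : 0 < r by exact: lt_trans rK.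
have rsup : g r / r <= sup E by apply: sup_upper_bound => //; exists r.
rewrite ger0_norm ?subr_ge0//.
pose q := Num.trunc (r / s); pose t := r - q%:R * s.
have /andP[q1 q2] : q%:R <= r / s < q.+1%:R.
  by apply: truncn_itv; rewrite divr_ge0// ltW.
have t0 : 0 <= t by rewrite subr_ge0 -ler_pdivlMr.
have := superadditive_mul q (ltW s0) t0 gD.
have -> : q%:R * s + t = r by rewrite /t; ring.
have gt := gN1 t t0.
have h : r / s * g s - `|g s| <= q%:R * g s.
  rewrite lerBlDr -lerBlDl -mulrBl; apply: le_trans (ler_norm _) _.
  rewrite normrM ler_piMl// ger0_norm ?subr_ge0// lerBlDl.
  by rewrite -natr1 in q2; exact: ltW.
move=> gq; have {gq} : r / s * g s - `|g s| - 1 <= g r by lra.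
rewrite -(ler_pM2r (x := r^-1)) ?invr_gt0// => gr.
have : (`|g s| + 1) / r < e / 2.
  by rewrite ltr_pdivrMr// mulrC -ltr_pdivrMr.
have E1 : (r / s * g s - `|g s| - 1) / r = g s / s - (`|g s| + 1) / r.
  by field; rewrite !gt_eqF.
rewrite E1 in gr; lra.
Unshelve. all: by end_near. Qed.

End fekete.

Section counting_windows.
Context (R : realType) (L : set R) (delta : R) (delta_gt0 : 0 < delta).
Context (L_sep : forall l g : R, L l -> L g -> l != g -> delta <= `|l - g|).
Local Notation window x r := (L `&` `[x, (x + r)%R]).

(** The integer part of (l - x) / delta separates the points of L. *)
Lemma fset_window_le (X : {fset R}) (x r : R) : 0 <= r ->
  [set` X] `<=` window x r -> #|` X|%:R <= r / delta + 1.
Proof.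
have d0 := delta_gt0; move=> r0 XL; pose f l := Num.trunc ((l - x) / delta).
have XP l : l \in X -> L l /\ x <= l <= x + r.
  by move=> /XL [Ll] /=; rewrite in_itv.
have fP l : l \in X -> (f l)%:R <= (l - x) / delta < (f l).+1%:R.
  move=> /XP[_ /andP[xl _]]; apply: truncn_itv.
  by rewrite divr_ge0 ?subr_ge0// ltW.
have finj : {in X &, injective f}.
  move=> l k lX kX flk; apply/eqP/negPn/negP => lk.
  have := L_sep (XP l lX).1 (XP k kX).1 lk.
  have /andP[l1 l2] := fP l lX; have /andP[k1 k2] := fP k kX.
  rewrite flk in l1 l2; rewrite -natr1 in l2 k2.
  rewrite leNgt => /negP; apply.
  rewrite ler_pdivlMr// in l1; rewrite ler_pdivlMr// in k1.
  rewrite ltr_pdivrMr// in l2; rewrite ltr_pdivrMr// in k2.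
  rewrite ltr_norml; apply/andP; split; lra.
have /andP[n1 n2] : (Num.trunc (r / delta))%:R <= r / delta <
    (Num.trunc (r / delta)).+1%:R by apply: truncn_itv; rewrite divr_ge0// ltW.
suff : (#|` X| <= (Num.trunc (r / delta)).+1)%N.
  by rewrite -(ler_nat R) -natr1 => h; apply: (le_trans h); rewrite lerD2r.
have : (size (map f X) <= size (iota 0 (Num.trunc (r / delta)).+1))%N.
  apply: uniq_leq_size; first by rewrite map_inj_in_uniq ?fset_uniq.
  move=> _ /mapP[l lX ->]; rewrite mem_iota add0n leq0n /= ltnS.
  have [_ /andP[xl lr]] := XP l lX; apply: le_truncn.
  by rewrite ler_pM2r ?invr_gt0//; lra.
by rewrite size_map size_iota.
Qed.

Lemma finite_window (x r : R) : 0 <= r -> finite_set (window x r).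
Proof.
move=> r0; apply: contrapT => inf.
have [X XL nX] := infinite_set_fset (Num.trunc (r / delta + 1)).+1 inf.
have := fset_window_le r0 XL; apply/negP; rewrite -ltNge.
have /andP[_ n2] : (Num.trunc (r / delta + 1))%:R <= r / delta + 1 <
    (Num.trunc (r / delta + 1)).+1%:R.
  by apply: truncn_itv; rewrite addr_ge0// divr_ge0// ltW.
by apply: (lt_le_trans n2); rewrite ler_nat.
Qed.

Lemma mem_window (x r l : R) : 0 <= r ->
  l \in fset_set (window x r) <-> L l /\ x <= l <= x + r.
Proof.
move=> r0; rewrite in_fset_set; last exact: finite_window.
split => [/set_mem[Ll]|[Ll lx]]; first by rewrite /= in_itv.
by apply/mem_set; split => //=; rewrite in_itv.
Qed.

Definition window_count (x r : R) : R := #|` fset_set (window x r)|%:R.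

Lemma counting_window (x r : R) : 0 <= r ->
  counting (window x r) = (window_count x r)%:E.
Proof.
move=> r0; rewrite /counting; case: asboolP => //.
by have := finite_window x r0.
Qed.

Lemma min_count_fin (r : R) : 0 <= r -> min_count L r \is a fin_num.
Proof.
move=> r0; rewrite ge0_fin_numE.
  apply: (@le_lt_trans _ _ (window_count 0 r)%:E); last exact: ltry.
  by apply: ereal_inf_lbound; exists 0 => //; rewrite counting_window.
by apply: le_ereal_inf_tmp => _ [x _ <-]; rewrite counting_window// lee_fin.
Qed.

Lemma min_count_le (x r : R) : 0 <= r ->
  fine (min_count L r) <= window_count x r.
Proof.
move=> r0; rewrite -lee_fin fineK ?min_count_fin//.
by apply: ereal_inf_lbound; exists x => //; rewrite counting_window.
Qed.

Lemma le_min_count (y r : R) : 0 <= r ->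
  (forall x, y <= window_count x r) -> y <= fine (min_count L r).
Proof.
move=> r0 yr; rewrite -lee_fin fineK ?min_count_fin//.
by apply: le_ereal_inf_tmp => _ [x _ <-]; rewrite counting_window// lee_fin.
Qed.

Lemma window_countD (x r s : R) : 0 <= r -> 0 <= s ->
  window_count x r + window_count (x + r) s <= window_count x (r + s) + 1.
Proof.
move=> r0 s0.
have f1 := finite_window x r0; have f2 := finite_window (x + r) s0.
have f3 := finite_window x (addr_ge0 r0 s0).
rewrite /window_count -natrD natr1 ler_nat -cardfsUI -addn1.
apply: leq_add.
  apply: fsubset_leq_card; apply/fsubsetP => l; rewrite in_fsetU => /orP[].
    move=> /(mem_window _ _ r0)[Ll /andP[a b]].
    by apply/mem_window; [exact: addr_ge0|split => //; apply/andP; split; lra].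
  move=> /(mem_window _ _ s0)[Ll /andP[a b]].
  by apply/mem_window; [exact: addr_ge0|split => //; apply/andP; split; lra].
rewrite -(cardfs1 (x + r)); apply: fsubset_leq_card; apply/fsubsetP => l.
rewrite in_fsetI => /andP[/(mem_window _ _ r0)[_ /andP[_ a]]].
move=> /(mem_window _ _ s0)[_ /andP[b _]].
by rewrite in_fset1 eq_le a b.
Qed.

(** Two adjacent windows share at most one point, so the minimal count minus one
    is superadditive. *)
Lemma lower_density_lim : exists2 l : R, lower_density L = l%:E &
  (fine (min_count L r) - 1) / r @[r --> +oo] --> l.
Proof.
have d0 := delta_gt0; pose g r := fine (min_count L r) - 1.
have [l gl] : exists l : R, g r / r @[r --> +oo] --> l.
  apply: (@fekete R g delta^-1) => [r s r0 s0|r r0|r r0].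
  - suff : fine (min_count L r) + fine (min_count L s) - 1 <=
        fine (min_count L (r + s)) by rewrite /g; lra.
    apply: le_min_count => [|x]; first exact: addr_ge0.
    have := window_countD x r0 s0; have := min_count_le x r0.
    have := min_count_le (x + r) s0; lra.
  - suff : 0 <= fine (min_count L r) by rewrite /g; lra.
    by apply: le_min_count => // x; rewrite ler0n.
  - rewrite /g lerBlDr mulrC; have r0' := ltW r0.
    apply: (le_trans (min_count_le 0 r0')).
    apply: fset_window_le => //.
    by rewrite fset_setK; [exact: subset_refl|exact: finite_window].
exists l => //; apply: cvg_lim => //.
have : (fun r : R => (g r / r + r^-1)%:E) @ +oo --> (l + 0)%:E.
  apply: cvg_EFin; first by near=> r.
  apply: cvgD => //; apply/gtr0_cvgV0; last exact: cvg_id.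
  by near=> r; near: r; apply: nbhs_pinfty_gt; exact: num_real.
rewrite addr0; apply: cvg_trans; apply: near_eq_cvg; near=> r.
have r0 : 0 <= r by near: r; apply: nbhs_pinfty_ge; exact: num_real.
rewrite -[X in _ = (_ * X)%E](fineK (min_count_fin r0)) -EFinM; congr EFin.
by rewrite /g; ring.
Unshelve. all: by end_near. Qed.

End counting_windows.

(** * From the completed measure to compact sets *)

Section completed_measure.
Context (R : realType).
Local Notation mu := (@lebesgue_measure R).
Local Notation cmu := (@completed_lebesgue_measure R).
Implicit Types (S K : set R).

(** S is the union of a Borel set and of a null set, and the completed measure
    agrees with the Lebesgue measure on Borel sets; inner regularity applies to
    the former. *)
Lemma compact_inner_approx S (y : R) : lebesgue_measurable S ->
  (cmu S < +oo)%E -> (y%:E < cmu S)%E ->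
  exists K, [/\ compact K, K `<=` S & y < fine (mu K)].
Proof.
move=> mS Soo yS.
move: mS; rewrite /lebesgue_measurable.
rewrite -completed_caratheodory_measurable g_sigma_completed_algebra_genE.
move=> [A /= mA [N [B [mB B0 NB]] ANS]].
have SA : cmu S = mu A.
  apply/eqP; rewrite eq_le; apply/andP; split; last first.
    by apply: le_outer_measure; rewrite -ANS; exact: subsetUl.
  apply: (@le_trans _ _ (cmu (A `|` B))).
    by apply: le_outer_measure; rewrite -ANS; exact: setUS.
  apply: (@le_trans _ _ (cmu A + cmu B)%E).
    exact: outer_measureU2.
  have -> : cmu B = 0%E by exact: B0.
  by rewrite adde0.
have Aoo : (mu A < +oo)%E by rewrite -SA.
have Afin : mu A \is a fin_num by rewrite ge0_fin_numE.
have e0 : 0 < fine (mu A) - y.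
  by rewrite subr_gt0 -lte_fin fineK// -SA.
have [K [cK KA mK]] := lebesgue_regularity_inner mA Aoo e0.
exists K; split => //; first by apply: (subset_trans KA); rewrite -ANS; exact: subsetUl.
have bK : mu K \is a fin_num by rewrite ge0_fin_numE// compact_finite_measure.
have msK : measurable K by exact: compact_measurable.
move: mK; rewrite measureD//.
have -> : A `&` K = K by apply/setIidPr.
rewrite -[X in (X - _ < _)%E](fineK Afin) -[X in (_ - X < _)%E](fineK bK).
by rewrite -EFinB lte_fin; lra.
Qed.

(** The Lebesgue measure is the image of its completion by the identity map,
    seen as a measurable map to the Borel sigma-algebra. *)
Lemma integ_le_L2norm S K (f : R -> R[i]) (h : R -> R) (eps : R) :
  lebesgue_measurable S -> bounded_measurable K -> K `<=` S -> continuous h ->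
  (forall t, Normc.normc (f t) ^+ 2 = h t) -> 0 < eps ->
  (L2norm S f < eps%:E)%E -> integ K h <= eps ^+ 2.
Proof.
move=> mS bK KS ch fh eps0; rewrite /L2norm Lnorm.unlock.
have nge0 (z : R[i]) : 0 <= Normc.normc z by case: z => u v; exact: sqrtr_ge0.
have h0 t : 0 <= h t by rewrite -fh sqr_ge0.
have mK : measurable K by exact: bK.1.
have mKc : (wlength (@idfun R))^*%mu.-cara.-measurable K.
  exact: sub_caratheodory.
have mid : measurable_fun setT
    (idfun : caratheodory_type (wlength (@idfun R))^*%mu -> measurableTypeR R).
  by move=> _ Y mY; rewrite setTI preimage_id; exact: sub_caratheodory.
have mh : measurable_fun [set: measurableTypeR R] h.
  exact: continuous_measurable_fun.
have -> : (fun t => `|((fun t => (Normc.normc (f t))%:E) \_ S) t| `^ 2)%E =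
    (fun t => (h t)%:E) \_ S.
  apply/funext => t; rewrite /patch; case: ifPn => tS /=.
    rewrite ger0_norm ?nge0//.
    by rewrite powR_mulrn ?nge0// fh.
  by rewrite normr0 powR0.
rewrite -integral_mkcond => Ieps.
have Ilt : (\int[cmu]_(x in S) (h x)%:E < (eps ^+ 2)%:E)%E.
  rewrite ltNge; apply/negP => le; move: Ieps; apply/negP; rewrite -leNgt.
  have -> : eps%:E = ((eps ^+ 2)%:E `^ 2^-1)%E.
    by rewrite poweR_EFin powR12_sqrt ?sqr_ge0// sqrtr_sqr ger0_norm// ltW.
  apply: gt0_ler_poweR => //; rewrite in_itv /= leey andbT.
    by rewrite lee_fin sqr_ge0.
  by apply: integral_ge0 => t _; rewrite lee_fin.
have KE : (\int[mu]_(x in K) (h x)%:E = \int[cmu]_(x in K) (h x)%:E)%E.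
  transitivity (\int[pushforward cmu
    (idfun : caratheodory_type (wlength (@idfun R))^*%mu -> measurableTypeR R)]_(x in K) (h x)%:E)%E.
    by apply: eq_measure_integral.
  rewrite ge0_integral_pushforward//.
  - apply/measurable_EFinP; exact: measurable_funTS.
  - by move=> t _; rewrite lee_fin.
have Kfin : (\int[mu]_(x in K) (h x)%:E)%E \is a fin_num.
  by apply: integrable_fin_num; [exact: mK|exact: continuous_integrable].
rewrite -lee_fin /Rintegral fineK// KE.
apply: le_trans (ltW Ilt).
apply: (@ge0_subset_integral _ _ _ cmu K S mKc mS) => //.
  apply/measurable_EFinP; apply: measurable_funTS.
  exact: (measurableT_comp mh mid).
by move=> t _; rewrite lee_fin.
Qed.

End completed_measure.

(** * Proof of the theorem *)

Section complex_residual.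
Context (R : realType).

Lemma normc_residual (F : {fset R}) (a : R -> R[i]) (w t : R) :
  Normc.normc (expi w t - \sum_(l <- F) a l * expi l t) ^+ 2 =
  residual F (fun l => complex.Re (a l)) (fun l => complex.Im (a l))
    (2 * pi * w) t.
Proof.
have sumE (s : seq R) : \sum_(l <- s) a l * expi l t = Complex
   (\sum_(l <- s) (complex.Re (a l) * cos (2 * pi * l * t) -
                   complex.Im (a l) * sin (2 * pi * l * t)))
   (\sum_(l <- s) (complex.Re (a l) * sin (2 * pi * l * t) +
                   complex.Im (a l) * cos (2 * pi * l * t))).
  elim: s => [|l s IH]; first by rewrite !big_nil.
  by rewrite !big_cons IH /expi; case: (a l).
by rewrite sumE /residual /expi /= sqr_sqrtr ?addr_ge0 ?sqr_ge0.
Qed.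

Lemma uniformly_complete_restrict (L S K : set R) : lebesgue_measurable S ->
  bounded_measurable K -> K `<=` S -> uniformly_complete L S ->
  exists2 C, 0 < C & real_uniformly_complete L K C.
Proof.
move=> mS bK KS [C C0 uc]; exists C => // w eta eta0.
have se0 : 0 < Num.sqrt eta by rewrite sqrtr_gt0.
have [F [a [FL aeps aC]]] := uc w (Num.sqrt eta) se0.
exists F, (fun l => complex.Re (a l)), (fun l => complex.Im (a l)); split => //.
  apply: le_trans aC; rewrite le_eqVlt; apply/orP; left; apply/eqP.
  apply: eq_bigr => l _; case: (a l) => u v /=.
  by rewrite sqr_sqrtr ?addr_ge0 ?sqr_ge0.
rewrite -(sqr_sqrtr (ltW eta0)).
apply: (integ_le_L2norm mS bK KS _ _ se0 aeps); first exact: continuous_residual.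
by move=> t; exact: normc_residual.
Qed.

End complex_residual.

Lemma min_count_lower_bound (R : realType) (L K : set R) (delta C y : R) :
  compact K -> 0 < delta -> 0 <= C -> 0 <= y -> y < fine (@lebesgue_measure R K) ->
  (forall l g : R, L l -> L g -> l != g -> delta <= `|l - g|) ->
  real_uniformly_complete L K C ->
  exists2 rho : R, 0 < rho &
    forall r, 2 * rho <= r -> y * (r - 2 * rho) <= fine (min_count L r).
Proof.
move=> cK d0 C0 y0 yK Lsep uc.
have [M M0 KM] : exists2 M : R, 0 < M & K `<=` `[- M, M].
  have [B [_ BK]] := compact_bounded cK.
  exists (`|B| + 1) => [|t Kt /=]; first by rewrite ltr_wpDl.
  by rewrite in_itv /= -ler_norml; apply: BK => //; rewrite ltr_pwDr// ler_norm.
have N0 : 0 < 2 * M by rewrite mulr_gt0.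
(* This value of eps turns |K| / (2 M) - eps into y / (2 M). *)
have e0 : 0 < (fine (@lebesgue_measure R K) - y) / (2 * M).
  by rewrite divr_gt0// subr_gt0.
have [rho rho0 count] := grid_count cK KM M0 d0 C0 e0 Lsep uc.
exists rho => // r r2; have r0 : 0 <= r by lra.
apply: (le_min_count d0 Lsep r0) => x.
pose u := (r - 2 * rho) * (2 * M).
have u0 : 0 <= u by rewrite mulr_ge0 ?subr_ge0// ltW.
have /andP[m1 m2] := truncn_itv u0.
have := count x r (Num.trunc u).+1 (fset_set (L `&` `[x, (x + r)%R])).
rewrite /window_count => H; apply: le_trans (H _ _); last 2 first.
- move=> k; rewrite -lerBrDl ler_pdivrMr//; apply: le_trans m1.
  by rewrite ler_nat -ltnS.
- by move=> l Ll lx; apply/(mem_window d0 Lsep).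
have -> : y * (r - 2 * rho) = u * (y / (2 * M)) by rewrite /u; field; rewrite gt_eqF.
have -> : fine (@lebesgue_measure R K) / (2 * M) -
    (fine (@lebesgue_measure R K) - y) / (2 * M) = y / (2 * M) by ring.
by rewrite ler_wpM2r ?(ltW m2)// divr_ge0// ltW.
Qed.

Theorem theorem1p4 (R : realType) (S L : set R)
  (mS : lebesgue_measurable S)
  (S_gt0 : (0 < @completed_lebesgue_measure R S)%E)
  (S_fin : (@completed_lebesgue_measure R S < +oo)%E)
  (L_ud : uniformly_discrete L)
  (L_uc : uniformly_complete L S) :
  (@completed_lebesgue_measure R S <= lower_density L)%E.
Proof.
have [delta d0 Lsep] := L_ud.
have [l -> lim_l] := lower_density_lim d0 Lsep.
have Sfin : @completed_lebesgue_measure R S \is a fin_num.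
  by rewrite ge0_fin_numE.
rewrite leNgt; apply/negP => lS.
pose sigma := fine (@completed_lebesgue_measure R S).
have sigmaE : completed_lebesgue_measure S = sigma%:E by rewrite fineK.
have sigma0 : 0 < sigma by rewrite -lte_fin -sigmaE.
have lsigma : l < sigma by rewrite -lte_fin -sigmaE.
(* y separates l from the measure of S; the maximum with 0 makes it
   nonnegative, so that a lower bound for m gives one for m y. *)
pose y := (Num.max l 0 + sigma) / 2.
have maxsigma : Num.max l 0 < sigma by rewrite gt_max lsigma.
have [lmax max0] : l <= Num.max l 0 /\ 0 <= Num.max l 0.
  by rewrite !le_max !lexx orbT.
have [ysigma ly y0] : [/\ y < sigma, l < y & 0 <= y].
  by rewrite /y; split; lra.
have yS : (y%:E < @completed_lebesgue_measure R S)%E by rewrite sigmaE lte_fin.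
have [K [cK KS yK]] := compact_inner_approx mS S_fin yS.
have bK : bounded_measurable K.
  split; first exact: compact_measurable.
  have [B [_ BK]] := compact_bounded cK.
  exists (`|B| + 1) => t Kt /=; rewrite in_itv /= -ler_norml.
  by apply: BK => //; rewrite ltr_pwDr// ler_norm.
have [C C0 uc] := uniformly_complete_restrict mS bK KS L_uc.
have [rho rho0 count] := min_count_lower_bound cK d0 (ltW C0) y0 yK Lsep uc.
have ly2 : l < (l + y) / 2 by lra.
have : \forall r \near pinfty_nbhs R, False.
  near=> r.
  have rl : (fine (min_count L r) - 1) / r < (l + y) / 2.
    by near: r; exact: cvgr_lt lim_l _ ly2.
  have r2 : 2 * rho <= r by near: r; apply: nbhs_pinfty_ge; exact: num_real.
  have rbig : (2 * rho * y + 1) / ((y - l) / 2) < r.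
    by near: r; apply: nbhs_pinfty_gt; exact: num_real.
  have r0 : 0 < r by lra.
  have yl0 : 0 < (y - l) / 2 by lra.
  rewrite ltr_pdivrMr// in rbig; rewrite ltr_pdivrMr// in rl.
  have := count r r2; lra.
by case/filter_ex.
Unshelve. all: by end_near. Qed.
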